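(* Let $m\in(0,\infty)$ and let $S_t$ denote the semigroup of the SIP$(m)$ process. For all $t\ge0$, all profiles $\overline\lambda:S\to[0,1)$ (if $S=\mathbb Z^d$: such that $\nu_{\overline\lambda}$-almost every configuration is tempered), all $n\ge1$ and all $x_1,\dots,x_n\in S$, $$K_{\nu_{\overline\lambda}S_t}(x_1,\dots,x_n)\ \ge\ \prod_{i=1}^n K_{\nu_{\overline\lambda}S_t}(x_i).$$ In particular, when the SIP$(m)$ is started from $\nu_{\overline\lambda}$, the variables $\{\eta_t(x):x\in S\}$ are positively correlated: for all $(x,y)\in S\times S$, $$\int\mathbb E^{SIP(m)}_\eta\big(\eta_t(x)\eta_t(y)\big)\,\nu_{\overline\lambda}(d\eta)\ \ge\ \int\mathbb E^{SIP(m)}_\eta(\eta_t(x))\,\nu_{\overline\lambda}(d\eta)\int\mathbb E^{SIP(m)}_\eta(\eta_t(y))\,\nu_{\overline\lambda}(d\eta).$$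
   Context: $S$ is either a finite set or $S=\mathbb Z^d$. $p(x,y)$ is an irreducible symmetric random walk transition probability on $S$: $p(x,y)=p(y,x)\ge 0$, $\sum_y p(x,y)=1$, $p(x,x)=0$. If $S=\mathbb Z^d$, $p$ is moreover translation invariant and of finite range. SIP$(m)$ (symmetric inclusion process) is the Markov process on $\mathbb N^S$ ($\mathbb N=\{0,1,2,\dots\}$) with generator, on local functions, $$Lf(\eta)=\sum_{x,y\in S}p(x,y)\,2\eta_x(m+2\eta_y)\big(f(\eta^{x,y})-f(\eta)\big),$$ where $\eta^{x,y}$ is obtained from $\eta$ by moving one particle from $x$ to $y$. $\mathbb E^{SIP(m)}_\eta$ is expectation for the process $(\eta_t)$ started from $\eta$; $\mu S_t$ is the law at time $t$ when started from the law $\mu$. If $S=\mathbb Z^d$, the process is started from tempered configurations (at most polynomial growth: $\eta(y)\le C(1+\|y\|)^k$ for some $C,k$ and all $y$), and it is constructed via self-duality, i.e. it satisfies $\mathbb E^{SIP(m)}_\eta D(\xi,\eta_t)=\mathbb E^{SIP(m)}_\xi D(\xi_t,\eta)$ for all finite particle configurations $\xi$, with $D$ defined next. Duality functions: $D(\xi,\eta)=\prod_x d(\xi_x,\eta_x)$ with $$d(k,l)=\frac{l!}{(l-k)!}\,\frac{\Gamma(m/2)}{\Gamma(m/2+k)}\quad(k\le l),\qquad d(k,l)=0\quad (k>l).$$ For $x_1,\dots,x_n\in S$, $\sum_{i=1}^n\delta_{x_i}$ is the configuration $\xi$ with $\xi(x)=\sum_{i}I(x_i=x)$. For a probability measure $\mu$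 on $\mathbb N^S$ the duality moment function is $K_\mu(x_1,\dots,x_n)=\int D(\sum_{i=1}^n\delta_{x_i},\eta)\,\mu(d\eta)$. For $0\le\lambda<1$, $\nu^m_\lambda$ is the probability measure on $\mathbb N$ given by $\nu^m_\lambda(n)=(1-\lambda)^{m/2}\frac{\lambda^n}{n!}\frac{\Gamma(m/2+n)}{\Gamma(m/2)}$; for $\overline\lambda:S\to[0,1)$, $\nu_{\overline\lambda}=\otimes_{x\in S}\nu^m_{\overline\lambda(x)}(d\eta_x)$. *)

(* Defs.v *)
From HB Require Import structures.
From mathcomp Require Import all_boot all_order all_algebra.
From mathcomp Require Import all_classical all_reals all_analysis.

Set Implicit Arguments.
Unset Strict Implicit.
Unset Printing Implicit Defensive.

Import Order.TTheory GRing.Theory Num.Theory.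
Import numFieldNormedType.Exports.

Local Open Scope classical_set_scope.
Local Open Scope ring_scope.

Inductive site_space := FiniteSites of finType | Lattice of nat.

Definition site (S : site_space) : countType :=
  match S with FiniteSites T => T | Lattice d => 'rV[int]_d end.

(* The sup norm; as all norms on Z^d are equivalent, the notions of finite range
   and temperedness below do not depend on this choice. *)
Definition znorm (d : nat) (x : 'rV[int]_d) : nat := (\max_(i < d) `|x ord0 i|)%N.

Definition coordinate_events (S : countType) : set (set (S -> nat)) :=
  [set A | exists (x : S) (B : set nat), A = [set eta | B (eta x)]].

Arguments coordinate_events S : clear implicits.

Notation config S := (g_sigma_algebraType (coordinate_events S)).

Definition finite_config (S : countType) (eta : config S) : Prop :=
  finite_set [set x | eta x != 0%N].

Definition tempered (R : realType) (d : nat) (eta : config 'rV[int]_d) : Prop :=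
  exists (C : R) (k : nat), forall y, (eta y)%:R <= C * (1 + (znorm y)%:R) ^+ k.

Definition allowed (R : realType) (S : site_space) : config (site S) -> Prop :=
  match S with
  | FiniteSites T => fun=> True
  | Lattice d => @tempered R d
  end.

Section RandomWalk.
Variable R : realType.

Definition irreducible_walk (S : countType) (p : S -> S -> R) : Prop :=
  forall x y, exists s : seq S, path (fun a b => 0 < p a b) x s /\ last x s = y.

Definition translation_invariant (d : nat)
    (p : 'rV[int]_d -> 'rV[int]_d -> R) : Prop :=
  forall x y z, p (x + z) (y + z) = p x y.

Definition finite_range (d : nat) (p : 'rV[int]_d -> 'rV[int]_d -> R) : Prop :=
  exists r : nat, forall x y, p x y != 0 -> (znorm (y - x) <= r)%N.

(* The sum over y is a sum over the finite support of p x, which is indeed finite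
   in both cases. *)
Record random_walk (S : site_space) (p : site S -> site S -> R) : Prop := {
  walk_ge0 : forall x y, 0 <= p x y;
  walk_sym : forall x y, p x y = p y x;
  walk_sum : forall x, \sum_(y \in [set: site S]) p x y = 1;
  walk_diag : forall x, p x x = 0;
  walk_irr : irreducible_walk p;
  walk_lattice :
    match S return (site S -> site S -> R) -> Prop with
    | FiniteSites _ => fun=> True
    | Lattice d => fun q => translation_invariant q /\ finite_range q
    end p }.

End RandomWalk.

Section Duality.
Variables (R : realType) (m : R).

Definition Gamma (a : R) : R :=
  \int[lebesgue_measure]_(x in `]0, +oo[) (x `^ (a - 1) * expR (- x)).

Definition duality1 (k l : nat) : R :=
  if (k <= l)%N then
    l`!%:R / (l - k)`!%:R * (Gamma (m / 2) / Gamma (m / 2 + k%:R))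
  else 0.

(* As duality1 0 l = 1, the product has finitely many factors different from 1
   whenever xi is finite. *)
Definition duality (S : countType) (xi eta : config S) : R :=
  \big[*%R/1]_(x \in [set: S]) duality1 (xi x) (eta x).

Definition sum_delta (S : countType) (n : nat) (x : 'I_n -> S) : config S :=
  fun y => (\sum_(i < n) (x i == y))%N.

Definition duality_moment (S : countType)
    (mu : {measure set (config S) -> \bar R}) (n : nat) (x : 'I_n -> S) : \bar R :=
  (\int[mu]_eta (duality (sum_delta x) eta)%:E)%E.

Definition nu_mass (lam : R) (n : nat) : R :=
  (1 - lam) `^ (m / 2) * (lam ^+ n / n`!%:R) * (Gamma (m / 2 + n%:R) / Gamma (m / 2)).

Definition nu_marginal (lam : R) (A : set nat) : \bar R :=
  \esum_(n in A) (nu_mass lam n)%:E.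

(* The product measure of the marginals, given by its values on rectangles. *)
Definition is_nu_product (S : countType) (lam : S -> R)
    (nu : probability (config S) R) : Prop :=
  forall (s : seq S) (A : S -> set nat), uniq s ->
    nu [set eta | forall x, x \in s -> A x (eta x)] =
    (\prod_(x <- s) nu_marginal (lam x) (A x))%E.

End Duality.

Section SIP.
Variables (R : realType) (m : R).

Definition move (S : countType) (x y : S) (eta : config S) : config S :=
  fun z => (eta z - (z == x) + (z == y))%N.

(* The sum is over the pairs (x, y) with nonzero summand: there are finitely many
   of them if p has finite range and either f is local or eta is finite. *)
Definition generator (S : countType) (p : S -> S -> R) (f : config S -> R)
    (eta : config S) : R :=
  \sum_(xy \in [set: S * S])
    p xy.1 xy.2 * (2 * (eta xy.1)%:R * (m + 2 * (eta xy.2)%:R))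
    * (f (move xy.1 xy.2 eta) - f eta).

Definition local_function (S : countType) (f : config S -> R) : Prop :=
  exists s : seq S, forall eta zeta : config S,
    (forall x, x \in s -> eta x = zeta x) -> f eta = f zeta.

(* Test functions for the process started from eta. From a finite configuration
   (any configuration, if S is finite) the process is a continuous-time Markov chain
   on a countable set, whose jump rates are bounded given the (conserved) number of
   particles: the generator then acts on every bounded function. *)
Definition test_function (S : countType) (eta : config S) (f : config S -> R) :
    Prop :=
  [/\ measurable_fun [set: config S] f,
      exists M : R, forall zeta, `|f zeta| <= M
    & local_function f \/ finite_config eta].

(* P t eta is the law at time t of the process started from eta; the values of P
   at negative times and at configurations that are not allowed are irrelevant. *)
Definition self_dual (S : countType) (D : config S -> Prop)
    (P : R -> R.-pker config S ~> config S) : Prop :=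
  forall (t : R) (xi eta : config S), 0 <= t -> finite_config xi -> D eta ->
    (\int[P t eta]_zeta (duality m xi zeta)%:E =
     \int[P t xi]_zeta (duality m zeta eta)%:E)%E.

(* sip_generator says that t |-> E_eta f(eta_t) has derivative E_eta Lf(eta_t) at
   every t >= 0 (a right derivative at t = 0, where it is Lf eta). *)
Record is_SIP (S : site_space) (p : site S -> site S -> R)
    (P : R -> R.-pker config (site S) ~> config (site S)) : Prop := {
  sip_start : forall (eta : config (site S)) (A : set (config (site S))),
    allowed R eta -> measurable A -> P 0 eta A = \d_eta A;
  sip_allowed : forall (t : R) (eta : config (site S)), 0 <= t -> allowed R eta ->
    {ae P t eta, forall zeta : config (site S), allowed R zeta};
  sip_markov : forall (s t : R) (eta : config (site S)) (A : set (config (site S))),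
    0 <= s -> 0 <= t -> allowed R eta -> measurable A ->
    P (s + t) eta A = (\int[P s eta]_zeta P t zeta A)%E;
  sip_generator : forall (eta : config (site S)) (f : config (site S) -> R),
    allowed R eta -> test_function eta f -> forall t : R, 0 <= t ->
    (P t eta).-integrable setT (EFin \o generator p f) /\
    (s - t)^-1 * (\int[P s eta]_zeta f zeta - \int[P t eta]_zeta f zeta)
      @[s --> within [set s | 0 <= s] t^'] -->
      \int[P t eta]_zeta generator p f zeta;
  sip_duality : match S with
    | FiniteSites _ => True
    | Lattice _ => self_dual (@allowed R S) P
    end }.

(* The law mu S_t, i.e. A |-> \int P t eta A mu(d eta): the constant kernel mu
   (from the one-point space) followed by P t. *)
Definition law_at (S : countType) (P : R -> R.-pker config S ~> config S)
    (mu : probability (config S) R) (t : R) : {measure set (config S) -> \bar R} :=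
  mkcomp_noparam (kprobability
      (measurable_cst (mu : pprobability (config S) R) : measurable_fun [set: unit] _))
    (P t) tt.

End SIP.

(* Main.v *)
(* Self-duality turns the duality moment of nu S_t into the expectation of
   F_rho(xi_t) = \prod_x rho(x)^(xi_t(x)), rho = lam / (1 - lam), for the process
   started from the finite configuration xi = \sum_i delta_(x_i). The generator L
   dominates, on functions F_g with g >= 0, the generator of independent walkers:
   the additional attraction term, symmetrized over pairs of particles, is a sum of
   multiples of (g z - g w)^2. Hence u_r = F_(g_r), where g_r(x) is the
   one-particle expectation of g at time r, satisfies d/dr u_r <= L u_r, so that
   E_xi F_g(xi_t) >= u_t(xi) = \prod_i g_t(x_i). On a finite set of sites,
   self-duality is obtained from L D(., eta) = L D(xi, .) by the same principle. *)

(* The process is known only through time derivatives of expectations of bounded functions. The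
   argument therefore runs on the countable sets [occ N] of configurations with [N] particles. On
   bounded functions there, L is bounded by [gen_bound m N]. The inequality d/dr u_r <= L u_r can
   then be replaced by the one-step estimate u_(r+h) <= E_h u_r + C h^2 with a uniform C, whose
   accumulated error vanishes as the step tends to 0. That the process stays in [occ N] is not
   postulated by [is_SIP]; it follows from L 1 = 0.

   As lam may approach 1 along the sites, rho may be unbounded. The comparison is passed from
   truncations of rho to rho by monotone convergence in the extended reals, where no finiteness of
   the moments has to be known beforehand.

   Of the function Gamma, only positivity and Gamma (a + 1) = a Gamma a enter the duality relations
   and the moments of nu.

   For the correlation of eta_t(x) with itself, D is a factorial moment rather than a square, and
   the factorial moment is the smaller of the two. *)
Require Import Defs.
From HB Require Import structures.
From mathcomp Require Import all_boot all_order all_algebra.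
From mathcomp Require Import all_classical all_reals all_analysis.
From mathcomp Require Import measurable_realfun ring lra zify.
Set Implicit Arguments.
Unset Strict Implicit.
Unset Printing Implicit Defensive.
Import Order.TTheory GRing.Theory Num.Theory.
Import numFieldNormedType.Exports.
Local Open Scope classical_set_scope.
Local Open Scope ring_scope.

(** * The Gamma function *)

Section GammaFunction.
Variable R : realType.
Implicit Types (a b c x : R) (n : nat).
Let mu := @lebesgue_measure R.

(** The exponent [b] corresponds to [a - 1] in [Gamma a]. *)
Definition gamma_density b x : R := x `^ b * expR (- x).

Lemma gamma_density_ge0 b x : 0 <= gamma_density b x.
Proof. by rewrite mulr_ge0 ?powR_ge0 ?expR_ge0. Qed.

Lemma is_derive_gamma_density b x : 0 < x ->
  is_derive x 1 (gamma_density b)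
    (b * gamma_density (b - 1) x - gamma_density b x).
Proof.
move=> x0; have d1 := is_derive1_powR b x0.
have d2 : is_derive x (1 : R) (fun y => expR (- y)) (- expR (- x)).
  have dN : is_derive x (1 : R) (fun y => - y) (- 1) by apply: is_deriveN.
  have dE := @is_derive1_comp R expR (fun y => - y) x _ _ (is_derive_expR _) dN.
  by apply: is_derive_eq dE _; rewrite mulrN1.
have d3 := is_deriveM d1 d2.
apply: is_derive_eq.
by rewrite /gamma_density /= /GRing.scale /=; ring.
Qed.

Lemma continuous_gamma_density b x : 0 < x ->
  {for x, continuous (gamma_density b)}.
Proof.
move=> x0; have [d _] := is_derive_gamma_density b x0.
by apply: differentiable_continuous; apply/derivable1_diffP.
Qed.

(** Compact intervals exhausting the open half-line: for negative [b] the density is singular at 0.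
    The shift to [n.+2] makes the interval nondegenerate already for [n = 0]. *)
Definition cutoff n : set R := `[n.+2%:R^-1, n.+2%:R]%classic.

Lemma cutoff_gt0 n x : cutoff n x -> 0 < x.
Proof.
by rewrite /cutoff/= in_itv/= => /andP[+ _]; apply: lt_le_trans; rewrite invr_gt0.
Qed.

Lemma measurable_cutoff n : measurable (cutoff n : set (measurableTypeR R)).
Proof. exact: measurable_itv. Qed.

Lemma nondecreasing_cutoff : nondecreasing_seq cutoff.
Proof.
move=> n k nk; apply/subsetPset => x; rewrite /cutoff/= !in_itv/= => /andP[h1 h2].
apply/andP; split; first by rewrite (le_trans _ h1)// lef_pV2 ?posrE// ler_nat.
by rewrite (le_trans h2)// ler_nat.
Qed.

Lemma bigcup_cutoff : \bigcup_n cutoff n = `]0, +oo[%classic.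
Proof.
apply/seteqP; split => [x [n _ /cutoff_gt0]|x].
  by rewrite /= in_itv/= andbT.
rewrite /= in_itv/= andbT => x0.
have [k kx] : exists k : nat, x + x^-1 <= k%:R.
  exists (Num.truncn (x + x^-1)).+1; apply: ltW; exact: truncnS_gt.
exists k => //; rewrite /cutoff/= in_itv/=.
have xV0 : 0 < x^-1 by rewrite invr_gt0.
have kk : (k%:R : R) <= k.+2%:R by rewrite ler_nat; lia.
apply/andP; split; last by lra.
rewrite -[leRHS]invrK lef_pV2 ?posrE//; lra.
Qed.

Lemma within_continuous_gamma_density b n :
  {within cutoff n, continuous (gamma_density b)}.
Proof.
apply: continuous_in_subspaceT => x /set_mem /cutoff_gt0 x0.
exact: continuous_gamma_density.
Qed.

Lemma integrable_gamma_density b n :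
  mu.-integrable (cutoff n) (EFin \o gamma_density b).
Proof.
apply: continuous_compact_integrable; first exact: segment_compact.
exact: within_continuous_gamma_density.
Qed.

Definition cut_gamma b n : R := \int[mu]_(x in cutoff n) gamma_density b x.

Lemma cut_gammaE b n :
  (cut_gamma b n)%:E = (\int[mu]_(x in cutoff n) (gamma_density b x)%:E)%E.
Proof.
rewrite fineK//; apply: integrable_fin_num; first exact: measurable_cutoff.
exact: integrable_gamma_density.
Qed.

Lemma nondecreasing_cut_gamma b : nondecreasing_seq (cut_gamma b).
Proof.
move=> n k nk; rewrite -lee_fin !cut_gammaE.
apply: ge0_subset_integral => //; try exact: measurable_cutoff.
- by case/integrableP: (integrable_gamma_density b k).
- by move=> x _; rewrite lee_fin gamma_density_ge0.
- exact/subsetPset/nondecreasing_cutoff.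
Qed.

(** The fundamental theorem of calculus for [gamma_density b]. It serves twice: to bound
    [cut_gamma], and in the limit as the functional equation of Gamma. *)
Lemma cut_gamma_rec b n :
  b * cut_gamma (b - 1) n - cut_gamma b n =
  gamma_density b n.+2%:R - gamma_density b n.+2%:R^-1.
Proof.
have lt2 : (n.+2%:R^-1 : R) < n.+2%:R.
  rewrite (@lt_trans _ _ 1)// ?ltr1n// invf_lt1 ?ltr1n//.
have : (\int[mu]_(x in cutoff n) (b * gamma_density (b - 1) x - gamma_density b x)%:E)%E
    = ((gamma_density b n.+2%:R)%:E - (gamma_density b n.+2%:R^-1)%:E)%E.
  apply: continuous_FTC2 => //.
  - apply: continuous_in_subspaceT => x /set_mem /cutoff_gt0 x0.
    apply: cvgB; last exact: continuous_gamma_density.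
    by apply: cvgM; [exact: cvg_cst|exact: continuous_gamma_density].
  - split.
    + move=> x; rewrite in_itv/= => /andP[h _].
      have x0 : 0 < x by rewrite (lt_trans _ h)// invr_gt0.
      by have [] := is_derive_gamma_density b x0.
    + by apply: cvg_at_right_filter; apply: continuous_gamma_density; rewrite invr_gt0.
    + by apply: cvg_at_left_filter; apply: continuous_gamma_density.
  - move=> x; rewrite in_itv/= => /andP[h _].
    have x0 : 0 < x by rewrite (lt_trans _ h)// invr_gt0.
    by rewrite derive1E; have [_ ->] := is_derive_gamma_density b x0.
rewrite -EFinB => h; have := congr1 fine h; rewrite /= => <-.
rewrite -[LHS]/(b * (\int[mu]_(x in cutoff n) gamma_density (b - 1) x) -
  \int[mu]_(x in cutoff n) gamma_density b x).
have i1 := integrable_gamma_density (b - 1) n.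
have mC := measurable_cutoff n.
rewrite -RintegralZl// -RintegralB//; last exact: integrable_gamma_density.
exact: (eq_integrable mC _ _ _ (integrableZl mC b i1)).
Qed.

(** The exponential dominates the single term x^(k+1) / (k+1)! of its series. *)
Lemma gamma_density_le b (k : nat) x : 1 <= x -> b <= k%:R ->
  gamma_density b x <= k.+1`!%:R / x.
Proof.
move=> x1 bk; have x0 : 0 < x by lra.
apply: (@le_trans _ _ (x ^+ k * expR (- x))).
  by rewrite ler_wpM2r ?expR_ge0// -powR_mulrn ?ler_powR// ltW.
rewrite expRN ler_pdivrMr ?expR_gt0// mulrAC ler_pdivlMr// -exprSr.
have := expR_ge1Dxn k (ltW x0); have f0 : 0 < k.+1`!%:R :> R by rewrite ltr0n fact_gt0.
move=> h; rewrite mulrC -ler_pdivrMr//; lra.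
Qed.

Lemma cvg_inv_nat : (n.+2%:R^-1 : R) @[n --> \oo] --> (0 : R).
Proof.
rewrite (cvg_shiftS (fun n => n.+1%:R^-1 : R)); exact: cvg_harmonic.
Qed.

Lemma cvg_inv_nat_right : (n.+2%:R^-1 : R) @[n --> \oo] --> 0^'+.
Proof.
move=> A /cvg_inv_nat A0.
suff : \forall n \near \oo, A n.+2%:R^-1 by [].
have {}A0 : \forall n \near \oo, (0 : R) < n.+2%:R^-1 -> A n.+2%:R^-1 by [].
by apply: filterS A0 => n; apply; rewrite invr_gt0.
Qed.

Lemma gamma_density_at_infty b :
  gamma_density b n.+2%:R @[n --> \oo] --> (0 : R).
Proof.
have [k bk] : exists k : nat, b <= k%:R.
  by exists (Num.truncn b).+1; apply: ltW; exact: truncnS_gt.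
apply: (@squeeze_cvgr _ _ _ _ (fun=> 0) (fun n => k.+1`!%:R * n.+2%:R^-1)).
- near=> n; rewrite gamma_density_ge0 /= gamma_density_le// ler1n//.
- exact: cvg_cst.
- rewrite -[X in _ --> X](mulr0 k.+1`!%:R).
  by apply: cvgM; [exact: cvg_cst|exact: cvg_inv_nat].
Unshelve. all: by end_near. Qed.

Lemma ge0_cvg_gamma_density_0 b : 0 < b ->
  gamma_density b n.+2%:R^-1 @[n --> \oo] --> (0 : R).
Proof.
move=> b0; apply: (@squeeze_cvgr _ _ _ _ (fun=> 0) (fun n => n.+2%:R^-1 `^ b)).
- near=> n; rewrite gamma_density_ge0 /= ler_piMr ?powR_ge0//.
- exact: cvg_cst.
- exact: cvg_comp cvg_inv_nat_right (powR_cvg0 b0).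
Unshelve. all: by end_near. Qed.

(** Natural exponents follow by induction from [cut_gamma_rec], and nonnegative ones from x^c <= 1 +
    x^k with k >= c. One more use of the recursion, at [b + 1 > 0], covers exponents between -1 and
    0. *)
Lemma cut_gamma_bounded b : -1 < b -> exists M, forall n, cut_gamma b n <= M.
Proof.
have small c n : 0 <= c -> gamma_density c n.+2%:R^-1 <= 1.
  move=> c0; rewrite -[leRHS]mulr1 ler_pM ?powR_ge0 ?expR_ge0//.
    have p1 : 1 `^ c = 1 :> R by rewrite powR1.
    rewrite -[leRHS]p1 ge0_ler_powR ?nnegrE ?invr_ge0//.
    by rewrite invf_le1// ler1n.
have nat_bounded (k : nat) : exists M, forall n, cut_gamma k%:R n <= M.
  elim: k => [|k [M hM]].
    exists 1 => n; have := cut_gamma_rec 0 n; rewrite mul0r sub0r.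
    by have := small 0 n (lexx _); have := gamma_density_ge0 0 (n.+2%:R : R); lra.
  exists (k.+1%:R * M + 1) => n; have := cut_gamma_rec k.+1%:R n.
  have -> : k.+1%:R - 1 = k%:R :> R by rewrite -natr1 addrK.
  have := small k.+1%:R n (ler0n _ _); have := gamma_density_ge0 k.+1%:R (n.+2%:R : R).
  have : k.+1%:R * cut_gamma k%:R n <= k.+1%:R * M by rewrite ler_wpM2l.
  by lra.
have ge0_bounded c : 0 <= c -> exists M, forall n, cut_gamma c n <= M.
  move=> c0; have [k ck] : exists k : nat, c <= k%:R.
    by exists (Num.truncn c).+1; apply: ltW; exact: truncnS_gt.
  have [M0 h0] := nat_bounded 0%N; have [M1 h1] := nat_bounded k.
  exists (M0 + M1) => n; apply: (le_trans _ (lerD (h0 n) (h1 n))).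
  have mC := measurable_cutoff n.
  rewrite /cut_gamma -RintegralD//; try exact: integrable_gamma_density.
  apply: le_Rintegral => //; first exact: integrable_gamma_density.
    have i0 c0' := integrable_gamma_density c0' n.
    exact: (eq_integrable mC _ _ _ (integrableD mC (i0 _) (i0 _))).
  move=> x /cutoff_gt0 x0; rewrite /gamma_density -mulrDl ler_wpM2r ?expR_ge0//.
  rewrite powRr0; have [x1|x1] := leP 1 x.
    by rewrite (le_trans (ler_powR x1 ck))// lerDr.
  rewrite (@le_trans _ _ 1) ?lerDl ?powR_ge0//.
  have p1 : 1 `^ c = 1 :> R by rewrite powR1.
  by rewrite -[leRHS]p1 ge0_ler_powR ?nnegrE// ltW.
move=> b1; have b10 : 0 < b + 1 by lra.
have [M hM] := ge0_bounded _ (ltW b10).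
have := cvgP _ (gamma_density_at_infty (b + 1)).
move=> /cvg_seq_bounded [D [_ hD]].
have D1 : D < D + 1 by rewrite ltrDl.
have {}hD := hD _ D1.
exists ((M + (D + 1)) / (b + 1)) => n; rewrite ler_pdivlMr//.
have := cut_gamma_rec (b + 1) n; rewrite addrK.
have := hD n I; rewrite /= ger0_norm ?gamma_density_ge0// => h.
have := gamma_density_ge0 (b + 1) (n.+2%:R^-1 : R).
have := hM n; rewrite mulrC.
lra.
Qed.

(** Monotone convergence. The uniform bound makes the integral finite, so that the real-valued
    integral in [Gamma] is not the default value 0. *)
Lemma cvg_cut_gamma b : -1 < b -> cut_gamma b n @[n --> \oo] --> Gamma (b + 1).
Proof.
move=> b1; have [M hM] := cut_gamma_bounded b1.
have h : (\int[mu]_(x in cutoff n) (gamma_density b x)%:E)%E @[n --> \oo] -->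
    (\int[mu]_(x in \bigcup_n cutoff n) (gamma_density b x)%:E)%E.
  apply: ge0_nondecreasing_set_cvg_integral.
  - exact: nondecreasing_cutoff.
  - exact: measurable_cutoff.
  - by move=> n; case/integrableP: (integrable_gamma_density b n).
  - by move=> n x _; rewrite lee_fin gamma_density_ge0.
rewrite bigcup_cutoff in h.
have -> : Gamma (b + 1) =
    fine (\int[mu]_(x in `]0%R, +oo[) (gamma_density b x)%:E)%E.
  by rewrite /Gamma addrK.
have {}h : (cut_gamma b n)%:E @[n --> \oo] -->
    (\int[mu]_(x in `]0%R, +oo[) (gamma_density b x)%:E)%E.
  by under eq_fun do rewrite cut_gammaE.
have hf : (\int[mu]_(x in `]0%R, +oo[) (gamma_density b x)%:E)%E \is a fin_num.
  rewrite ge0_fin_numE; last by apply: integral_ge0 => x _; rewrite lee_fin gamma_density_ge0.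
  apply: (@le_lt_trans _ _ M%:E); last exact: ltry.
  rewrite -(cvg_lim _ h)//; apply: lime_le; first exact: cvgP h.
  by apply: nearW => n; rewrite lee_fin.
by rewrite -(fineK hf) in h; exact: fine_cvg h.
Qed.

Lemma Gamma_gt0 a : 0 < a -> 0 < Gamma a.
Proof.
move=> a0; have a1 : -1 < a - 1 by lra.
have := cvg_cut_gamma a1; rewrite subrK => h.
apply: (@lt_le_trans _ _ (cut_gamma (a - 1) 0)); last first.
  rewrite -(cvg_lim _ h)//; apply: nondecreasing_cvgn_le; last exact: cvgP h.
  exact: nondecreasing_cut_gamma.
(* A lower bound of the density on [1/2, 2], which is [cutoff 0]: the power is smallest at the left
   or the right end according to the sign of the exponent, the exponential always at the right
   end. *)
pose c := (if 0 <= a - 1 then 2^-1 else 2) `^ (a - 1) * expR (- 2) : R.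
have c0 : 0 < c by rewrite mulr_gt0 ?expR_gt0//; case: ifP; rewrite powR_gt0 ?invr_gt0.
have mC := measurable_cutoff 0.
have i1 : mu (cutoff 0) = (2 - 2^-1)%:E.
  by rewrite /mu /cutoff lebesgue_measure_itv/= lte_fin ifT//; lra.
have ic : mu.-integrable (cutoff 0) (EFin \o cst c).
  apply: continuous_compact_integrable; first exact: segment_compact.
  by apply: continuous_subspaceT => x; exact: cst_continuous.
apply: (@lt_le_trans _ _ (\int[mu]_(x in cutoff 0) cst c x)).
  rewrite Rintegral_cst//; have -> : fine (mu (cutoff 0)) = 2 - 2^-1 by rewrite i1.
  by rewrite mulr_gt0//; lra.
apply: le_Rintegral => //; first exact: integrable_gamma_density.
move=> x; rewrite /cutoff/= in_itv/= => /andP[x1 x2].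
rewrite /c /gamma_density ler_pM ?powR_ge0 ?expR_ge0 ?ler_expR ?lerN2//.
have x0 : 0 < x by rewrite (lt_le_trans _ x1)// invr_gt0.
case: ifPn => [e0|]; first by rewrite ge0_ler_powR ?nnegrE ?invr_ge0// ltW.
rewrite -ltNge => e0; rewrite -(opprK (a - 1)) !(powRN _ (- (a - 1))).
rewrite lef_pV2 ?posrE ?powR_gt0// ge0_ler_powR ?nnegrE ?(ltW x0)//; lra.
Qed.

Lemma GammaS a : 0 < a -> Gamma (a + 1) = a * Gamma a.
Proof.
move=> a0; have a1 : -1 < a - 1 by lra.
have aN1 : -1 < a by lra.
have h1 := cvg_cut_gamma a1; rewrite subrK in h1.
have h2 := cvg_cut_gamma aN1.
have h3 := cvgB (gamma_density_at_infty a) (ge0_cvg_gamma_density_0 a0).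
have h4 := cvgB (cvgM (cvg_cst a) h1) (h3 _).
have e : (cst a \* cut_gamma (a - 1) -
  ((fun n => gamma_density a n.+2%:R) - (fun n => gamma_density a n.+2%:R^-1))) = cut_gamma a.
  apply/funext => n; rewrite !fctE /=.
  by have := cut_gamma_rec a n; lra.
have h5 : cut_gamma a n @[n --> \oo] --> a * Gamma a - (0 - 0).
  by rewrite -e; exact: h4.
by have := cvg_unique _ h2 h5; rewrite !subr0; apply.
Qed.

End GammaFunction.

(** * Finite configurations *)

Section Configurations.
Variable S : countType.
Implicit Types (eta zeta : config S) (s : seq S) (N : nat).

(** Finite configurations are handled as lists of particle positions, so that sums and products run
    over particles, with multiplicity. *)
Definition conf s : config S := fun y => count_mem y s.

(** The [N]-particle sector. It is countable with measurable points, so every function is measurable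
    on it. *)
Definition occ N : set (config S) := [set conf s | s in [set s | size s = N]].

Lemma occ_conf s : occ (size s) (conf s).
Proof. by exists s. Qed.

Lemma measurable_coordinate (x : S) (B : set nat) :
  measurable [set eta : config S | B (eta x)].
Proof. by apply: sub_sigma_algebra; exists x, B. Qed.

(** One condition per site, enumerated through [pickle]; integers that code no site impose no
    condition. *)
Lemma measurable_config1 eta : measurable [set eta].
Proof.
pose F (n : nat) : set (config S) :=
  if unpickle n is Some x then [set zeta | zeta x = eta x] else setT.
have -> : [set eta] = \bigcap_n F n.
  apply/seteqP; split=> [zeta -> n _|zeta h].
    by rewrite /F; case: unpickle.
  apply/funext => x; have := h (pickle x) I.
  by rewrite /F pickleK.
apply: bigcapT_measurable => n; rewrite /F; case: unpickle => // x.
exact: (measurable_coordinate x [set eta x]).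
Qed.

Lemma countable_occ N : countable (occ N).
Proof. by apply: (card_le_trans (card_image_le _ _)); exact: countableP. Qed.

Lemma measurable_occ N : measurable (occ N).
Proof. by apply: countable_measurable; [exact: measurable_config1|exact: countable_occ]. Qed.

Lemma measurable_fun_occ N d (T : measurableType d) (f : config S -> T) :
  measurable_fun (occ N) f.
Proof.
move=> _ B _; apply: countable_measurable; first exact: measurable_config1.
apply: sub_countable (countable_occ N); apply: subset_card_le; exact: subIsetl.
Qed.

Lemma conf_count s x : x \in s = (0 < conf s x)%N.
Proof. by rewrite /conf -has_count has_pred1. Qed.

Lemma move_conf s x y : x \in s -> move x y (conf s) = conf (y :: rem x s).
Proof.
move=> xs; apply/funext => z; rewrite /move /conf /= count_rem xs /= addnC.
by rewrite [x == z]eq_sym [y == z]eq_sym.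
Qed.

Lemma move_moveK eta x y : (0 < eta x)%N -> move y x (move x y eta) = eta.
Proof.
move=> ex; apply/funext => z; rewrite /move.
by have [->|zx] := eqVneq z x; have [|] := eqVneq z y => *; subst; lia.
Qed.

(** A move out of an empty site would create a particle, because the subtraction in [move] is
    truncated; the generator gives such moves rate 0. *)
Lemma move_occ N eta x y : (0 < eta x)%N -> occ N (move x y eta) <-> occ N eta.
Proof.
have imp a b zeta : (0 < zeta a)%N -> occ N zeta -> occ N (move a b zeta).
  move=> + [s sN zE]; rewrite -zE -conf_count => za.
  exists (b :: rem a s); last by rewrite move_conf.
  by rewrite /= size_rem// prednK -?sN //; case: s {sN zE} za.
move=> ex; split; last exact: imp.
move=> /(imp y x); rewrite move_moveK//; apply.
by rewrite /move eqxx; lia.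
Qed.

Lemma finite_config_conf s : finite_config (conf s).
Proof.
apply: (@sub_finite_set _ _ [set` s]); last exact: finite_seq.
by move=> x /=; rewrite -lt0n -conf_count.
Qed.

Lemma finite_configP eta : finite_config eta -> exists s, eta = conf s.
Proof.
move=> /finite_seqP[s hs].
exists (flatten [seq nseq (eta x) x | x <- undup s]).
apply/funext => y; rewrite /conf count_flatten -map_comp sumnE big_map.
under eq_bigr do rewrite /= count_nseq /=.
have := congr1 (fun A => A y) hs; rewrite /= -mem_undup => /esym ys.
have [yu|yu] := boolP (y \in undup s).
  rewrite (bigD1_seq y) ?undup_uniq//= eqxx mul1n big1 ?addn0// => i /negbTE ->.
  by rewrite mul0n.
rewrite big_seq big1 => [|i iu]; last first.
  by case: eqP => [iy|_]; rewrite ?mul0n//; rewrite -iy iu in yu.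
by apply/eqP/negbNE/negP => h; move/negP: yu; apply; rewrite ys.
Qed.

Lemma sum_deltaE n (x : 'I_n -> S) : sum_delta x = conf (codom x).
Proof.
apply/funext => y; rewrite /sum_delta /conf codomE count_map -sum1_count.
by rewrite [RHS]big_mkcond big_enum; apply: eq_bigr => i _ /=; case: (x i == y).
Qed.

End Configurations.

(** * Integrals against mixtures, and over sets of full measure *)

Section Mixtures.
Import HBNNSimple.
Variables (R : realType) (S : countType).
Variable P : R -> R.-pker config S ~> config S.

Lemma integral_law_at (nu : probability (config S) R) (t : R) (f : config S -> \bar R) :
  (forall zeta, 0 <= f zeta)%E -> measurable_fun [set: config S] f ->
  (\int[law_at P nu t]_zeta f zeta = \int[nu]_eta \int[P t eta]_zeta f zeta)%E.
Proof.
move=> f0 mf.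
have := @integral_kcomp _ _ _ unit (config S) (config S) R
  (kprobability (measurable_cst (nu : pprobability (config S) R) : measurable_fun [set: unit] _))
  (kernel.kernel_snd (P t)) tt f f0 mf.
move=> <-; exact: eq_measure_integral.
Qed.

(** The function [f] is only known to be measurable on [D]. Both integrals are therefore compared as
    suprema over simple functions, which are measurable everywhere. *)
Lemma ge0_integral_full_measure (mu : {measure set (config S) -> \bar R})
    (D : set (config S)) (f : config S -> \bar R) :
  measurable D -> mu (~` D) = 0%E -> (forall zeta, 0 <= f zeta)%E ->
  measurable_fun D f ->
  (\int[mu]_zeta f zeta = \int[mu]_(zeta in D) f zeta)%E.
Proof.
move=> mD muD f0 mfD; apply/eqP; rewrite eq_le; apply/andP; split.
  rewrite ge0_integralTE//; apply: ge_ereal_sup => _ [h hf <-].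
  rewrite -integralT_nnsfun.
  rewrite (@ge0_negligible_integral _ _ _ _ setT (~` D))//; first last.
  - by move=> x _; rewrite lee_fin.
  - exact/measurable_EFinP.
  - exact: measurableC.
  rewrite setTD setCK; apply: ge0_le_integral => //.
  - by move=> x _; rewrite lee_fin.
  - by apply/measurable_EFinP; exact: measurable_funTS.
rewrite [leRHS]ge0_integralTE// ge0_integralE//; apply: ereal_sup_le => _ [h hf <-].
exists h => //= x; apply: (le_trans (hf x)).
by rewrite patchE; case: ifP.
Qed.

End Mixtures.

(** * The generator at finite configurations *)

Section GeneratorOnFiniteConfigurations.
Variables (R : realType) (m : R) (S : countType) (p : S -> S -> R).
Hypothesis m_gt0 : 0 < m.
Hypothesis p_ge0 : forall x y, 0 <= p x y.
Hypothesis p_sum : forall x, \sum_(y \in [set: S]) p x y = 1.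
Implicit Types (s : seq S) (f g : config S -> R).
Local Notation L := (generator m p).

(** A common finite list of target sites for all particles of [s], which turns the generator at
    [conf s] into a finite double sum. *)
Definition covers (Y s : seq S) :=
  uniq Y /\ forall z, z \in s -> forall y, p z y != 0 -> y \in Y.

(** A sum with infinite support has the default value 0, contrary to [p_sum]. *)
Lemma neighbours_finite x : finite_set [set y | p x y != 0].
Proof.
apply: contrapT => inf; have := p_sum x; rewrite fsbig_dflt.
  by move=> /esym/eqP; rewrite oner_eq0.
move=> fin; apply: inf; apply: sub_finite_set fin => y /= /eqP pxy.
by split.
Qed.

Lemma exists_covers s : exists Y, covers Y s /\ {subset s <= Y}.
Proof.
have nbrs x : exists t : seq S, forall y, p x y != 0 -> y \in t.
  have /finite_seqP[t ht] := neighbours_finite x; exists t => y pxy.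
  by have : [set y | p x y != 0] y by []; rewrite ht.
have [N hN] := choice nbrs.
exists (undup (s ++ flatten (map N s))); split; last first.
  by move=> x xs; rewrite mem_undup mem_cat xs.
split; first exact: undup_uniq.
move=> z zs y pzy; rewrite mem_undup mem_cat; apply/orP; right.
by apply/flattenP; exists (N z); [exact: map_f|exact: hN].
Qed.

Lemma covers_sum Y s z : covers Y s -> z \in s -> \sum_(y <- Y) p z y = 1.
Proof.
move=> [uY cY] zs; rewrite -(p_sum z) (fsbigE Y)//.
  by apply: eq_bigl => i; rewrite in_setT.
by move=> y _; apply: contraNeq; exact: cY.
Qed.

(* One term per particle z of s, rather than per site as in the definition. *)
Lemma generator_conf f s Y : covers Y s ->
  L f (conf s) = \sum_(z <- s) \sum_(y <- Y)
    p z y * (2 * (m + 2 * (count_mem y s)%:R)) *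
    (f (conf (y :: rem z s)) - f (conf s)).
Proof.
move=> [uY cY]; rewrite /generator.
rewrite (fsbigE [seq (x, y) | x <- undup s, y <- Y]) //=; last 2 first.
- by apply: allpairs_uniq => //; [exact: undup_uniq|move=> [? ?] [? ?]].
- move=> [x y] _ /= hxy; have [xs|xs] := boolP (x \in s); last first.
    by rewrite conf_count -eqn0Ngt in xs; rewrite (eqP xs) mulr0 mul0r mulr0 mul0r.
  have [->|/(cY _ xs) yY] := eqVneq (p x y) 0; first by rewrite !mul0r.
  by case/negP: hxy; apply/allpairsP; exists (x, y); rewrite mem_undup.
under eq_bigl do rewrite in_setT.
rewrite big_allpairs_dep /= -[RHS]big_undup_iterop_count /=.
apply: eq_big_seq => x; rewrite mem_undup => xs.
rewrite -[RHS]/(_ *+ count_mem x s) -sumrMnl; apply: eq_bigr => y _.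
rewrite move_conf// -mulr_natl /conf; ring.
Qed.

(** Each of the [N] particles jumps at total rate at most 2 (m + 2N), and a jump changes a function
    bounded by M by at most 2M. *)
Definition gen_bound (N : nat) : R := 4 * N%:R * (m + 2 * N%:R).

Lemma gen_bound_ge0 N : 0 <= gen_bound N.
Proof. by rewrite mulr_ge0 ?mulr_ge0// addr_ge0 ?(ltW m_gt0)// mulr_ge0. Qed.

Lemma generator_bounded f N (M : R) : (forall zeta, occ N zeta -> `|f zeta| <= M) ->
  forall zeta, occ N zeta -> `|L f zeta| <= gen_bound N * M.
Proof.
move=> fM _ [s sN <-]; have [Y [cY _]] := exists_covers s.
rewrite (generator_conf f cY); apply: (le_trans (ler_norm_sum _ _ _)).
have -> : gen_bound N * M = \sum_(z <- s) (4 * (m + 2 * N%:R) * M).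
  by rewrite big_const_seq count_predT sN iter_addr_0 /gen_bound -mulr_natl; ring.
have M0 : 0 <= M.
  have : occ N (conf s) by exists s.
  by move=> /fM; apply: le_trans.
rewrite !big_seq; apply: ler_sum => z zs.
apply: (le_trans (ler_norm_sum _ _ _)).
rewrite -[leRHS]mul1r -[X in _ <= X * _](covers_sum cY zs) mulr_suml.
rewrite !big_seq; apply: ler_sum => y yY.
rewrite normrM normrM (ger0_norm (p_ge0 _ _)) -mulrA ler_wpM2l//.
have mc : 0 <= 2 * (m + 2 * (count_mem y s)%:R).
  by rewrite mulr_ge0// addr_ge0 ?(ltW m_gt0)// mulr_ge0.
rewrite (ger0_norm mc).
apply: (@le_trans _ _ (2 * (m + 2 * N%:R) * (M + M))); last first.
  by rewrite le_eqVlt; apply/orP; left; apply/eqP; ring.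
rewrite ler_pM//.
  by rewrite ler_pM2l// lerD2l ler_pM2l// ler_nat -sN count_size.
apply: (le_trans (ler_normB _ _)); rewrite lerD// fM//; last by exists s.
exists (y :: rem z s) => //=; rewrite size_rem// prednK -?sN//.
by case: s zs {sN cY fM M0 mc}.
Qed.

(** Jumps of nonzero rate conserve the number of particles. Hence a function that is bounded only on
    [occ N] can be extended by 0 to a bounded test function. *)
Lemma generator_restrict f N : L (f \_ (occ N)) = (L f) \_ (occ N).
Proof.
apply/funext => zeta; rewrite /generator [RHS]patchE.
have [zN|zN] := boolP (zeta \in occ N).
  apply: eq_fsbigr => -[x y] _ /=.
  have [z0|] := posnP (zeta x); first by rewrite z0 mulr0 mul0r mulr0 !mul0r.
  move=> /(move_occ N y) h; congr (_ * _); rewrite !patchE zN.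
  by rewrite inE in zN; rewrite ifT// inE h.
rewrite [LHS]fsbig1// => -[x y] _ /=.
have [z0|] := posnP (zeta x); first by rewrite z0 mulr0 mul0r mulr0 !mul0r.
move=> /(move_occ N y) h; rewrite !patchE (negbTE zN) ifN ?subr0 ?mulr0//.
by apply: contraNN zN; rewrite !inE h.
Qed.

Lemma generator_cst (c : R) : L (cst c) = cst 0.
Proof. by apply/funext => zeta; rewrite /generator fsbig1// => i _; rewrite subrr mulr0. Qed.

End GeneratorOnFiniteConfigurations.

(** * Mean value inequality on the half-line *)

Section HalfLineDerivative.
Variable R : realType.
Implicit Types (phi psi : R -> R) (t a M T : R).

(** The form of differentiability provided by [sip_generator]: two-sided for [t > 0], from the right
    at 0. *)
Definition half_line_derivative phi psi := forall t, 0 <= t ->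
  (s - t)^-1 * (phi s - phi t) @[s --> within [set s | 0 <= s] t^'] --> psi t.

Lemma half_line_derivative_is_derive phi psi t : half_line_derivative phi psi ->
  0 < t -> is_derive t 1 phi (psi t).
Proof.
move=> hd t0.
have sh : h + t @[h --> 0^'] --> within [set s | 0 <= s] t^'.
  move=> A [e /= e0 eA]; rewrite /fmap /=.
  have d0 : 0 < Num.min e t by rewrite lt_min e0.
  exists (Num.min e t) => //= h /= h1 h2.
  move: h1; rewrite sub0r normrN lt_min => /andP[he ht].
  apply: eA => /=; first by rewrite opprD addrCA subrr addr0 normrN.
    by apply: contra_neq h2 => e1; move: e1 => /(congr1 (fun z => z - t)); rewrite addrK subrr.
  by move: ht; rewrite ltr_norml; lra.
have q : h^-1 *: (phi (h *: 1 + t) - phi t) @[h --> 0^'] --> psi t.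
  have := cvg_comp _ _ sh (hd t (ltW t0)).
  apply: cvg_trans; apply: near_eq_cvg; near=> h => /=.
  by rewrite addrK /GRing.scale /= mulr1.
by apply: DeriveDef; [exact: cvgP q|exact: cvg_lim q].
Unshelve. all: by end_near. Qed.

Lemma half_line_derivative_right_continuous phi psi : half_line_derivative phi psi ->
  phi s @[s --> 0^'+] --> phi 0.
Proof.
move=> /(_ 0 (lexx _)) h.
have sub : (0 : R)^'+ `=>` within [set s | 0 <= s] (0 : R)^'.
  move=> A [e /= e0 eA]; exists e => // s /= s1 s0.
  by apply: eA => //=; [rewrite gt_eqF|exact: ltW].
have {}h : (s - 0)^-1 * (phi s - phi 0) @[s --> 0^'+] --> psi 0.
  by apply: cvg_trans h; exact: cvg_app.
have s0 : s @[s --> (0 : R)^'+] --> (0 : R) by apply: cvg_within.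
have := cvgD (cvg_cst (phi 0)) (cvgM s0 h).
move=> /(_ _ _ _ _); rewrite mul0r addr0.
apply: cvg_trans; apply: near_eq_cvg; near=> s.
have sn0 : s != 0 by rewrite gt_eqF//; near: s; exact: nbhs_right_gt.
by rewrite !fctE /= subr0 mulrA divff// mul1r addrC subrK.
Unshelve. all: by end_near. Qed.

(** The slope [a] is free: [a = 0] gives first-order bounds (and constancy if [M = 0]), while the
    derivative at 0 gives second-order bounds. *)
Lemma half_line_mean_value phi psi a M T : half_line_derivative phi psi -> 0 <= T ->
  (forall t, 0 <= t <= T -> `|psi t - a| <= M) -> `|phi T - phi 0 - T * a| <= T * M.
Proof.
move=> hd; rewrite le_eqVlt => /predU1P[<- _|T0 pM].
  by rewrite subrr !mul0r subrr normr0.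
have [||c] := @MVT R phi psi 0 T T0.
- by move=> x; rewrite in_itv/= => /andP[x0 _]; apply: half_line_derivative_is_derive.
- apply/continuous_within_itvP => //; split.
  + move=> x; rewrite in_itv/= => /andP[x0 _].
    have [d _] := half_line_derivative_is_derive hd x0.
    by apply: differentiable_continuous; apply/derivable1_diffP.
  + exact: half_line_derivative_right_continuous hd.
  + have [d _] := half_line_derivative_is_derive hd T0.
    by apply: cvg_at_left_filter; apply: differentiable_continuous; apply/derivable1_diffP.
rewrite in_itv/= => /andP[c0 cT] ->; rewrite subr0 mulrC -mulrBr normrM gtr0_norm//.
by rewrite ler_pM2l// pM// !ltW.
Qed.

End HalfLineDerivative.

(** * Limits of products of extended reals *)

Section ExtendedProducts.
Variables (R : realType) (I : eqType).
Local Open Scope ereal_scope.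

(** Positive limits exclude the products 0 * +oo, at which multiplication is not continuous.
    Positivity of the limit product is what carries the induction. *)
Lemma cvg_prode_gt0 (s : seq I) (u : I -> nat -> \bar R) (l : I -> \bar R) :
  (forall i, i \in s -> 0 < l i) -> (forall i, i \in s -> u i n @[n --> \oo] --> l i) ->
  (\prod_(i <- s) u i n @[n --> \oo] --> \prod_(i <- s) l i) /\ 0 < \prod_(i <- s) l i.
Proof.
elim: s => [|i s IH] l0 ul.
  rewrite big_nil lte01; split => //.
  by under eq_fun do rewrite big_nil; exact: cvg_cst.
have [IH1 IH2] : \prod_(j <- s) u j n @[n --> \oo] --> \prod_(j <- s) l j /\ 0 < \prod_(j <- s) l j.
  by apply: IH => j js; [apply: l0|apply: ul]; rewrite inE js orbT.
have li0 : 0 < l i by rewrite l0// mem_head.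
rewrite big_cons; split; last by rewrite mule_gt0.
under eq_fun do rewrite big_cons.
apply: cvgeM => //; last by apply: ul; rewrite mem_head.
by rewrite mule_defE (gt_eqF li0) (gt_eqF IH2).
Qed.

(* If some limit vanishes then so does the product, as 0 * +oo = 0. *)
Lemma prode_lim_le (s : seq I) (u : I -> nat -> \bar R) (l : I -> \bar R) K :
  (forall i n, 0 <= u i n) -> (forall i, u i n @[n --> \oo] --> l i) ->
  (forall n, \prod_(i <- s) u i n <= K) -> \prod_(i <- s) l i <= K.
Proof.
move=> u0 ul uK.
have K0 : 0 <= K by apply: (le_trans _ (uK 0%N)); exact: prode_ge0.
have l0 i : 0 <= l i.
  by rewrite -(cvg_lim _ (ul i))//; apply: lime_ge; [exact: cvgP (ul i)|exact: nearW].
have [/hasP[i si /eqP li]|/hasPn ln0] := boolP (has (fun i => l i == 0) s).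
  by rewrite (big_rem i)//= li mul0e.
have [] := @cvg_prode_gt0 s u l _ (fun i _ => ul i).
  by move=> i /ln0 li; rewrite lt_neqAle eq_sym li l0.
move=> h _; rewrite -(cvg_lim _ h)//; apply: lime_le; first exact: cvgP h.
exact: nearW.
Qed.

End ExtendedProducts.

(** * Power products *)

Section PowerProducts.
Variables (R : realType) (S : countType).
Implicit Types (g : S -> R) (s : seq S).

Definition power_product g (zeta : config S) : R :=
  \big[*%R/1]_(x \in [set: S]) g x ^+ zeta x.

Lemma power_product_conf g s : power_product g (conf s) = \prod_(x <- s) g x.
Proof.
rewrite /power_product (fsbigE (undup s)) ?undup_uniq//; last first.
  by move=> x _; rewrite mem_undup conf_count -eqn0Ngt => /eqP ->.
under eq_bigl do rewrite in_setT.
by rewrite -[RHS]big_undup_iterop_count.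
Qed.

Lemma prod_rem g s z : z \in s -> \prod_(x <- s) g x = g z * \prod_(x <- rem z s) g x.
Proof. by move=> zs; rewrite (perm_big _ (perm_to_rem zs)) big_cons. Qed.

Lemma prod01 g s : (forall x, 0 <= g x <= 1) -> 0 <= \prod_(x <- s) g x <= 1.
Proof.
move=> g01; elim: s => [|x s /andP[p0 p1]]; first by rewrite big_nil ler01 lexx.
have /andP[g0 g1] := g01 x.
by rewrite big_cons mulr_ge0//= mulr_ile1.
Qed.

Lemma power_productZ (c : R) g s :
  power_product (fun x => c * g x) (conf s) = c ^+ size s * power_product g (conf s).
Proof. by rewrite !power_product_conf big_split/= big_const_seq count_predT iter_mulr_1. Qed.

(** The factors are exchanged one at a time; the others, lying in [0, 1], do not enlarge the
    error. *)
Lemma prod_increment (a b : S -> R) (d : R) s : 0 <= d ->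
  (forall x, 0 <= a x <= 1) -> (forall x, 0 <= b x <= 1) ->
  (forall x, `|b x - a x| <= d) ->
  `|\prod_(x <- s) b x - \prod_(x <- s) a x| <= (size s)%:R * d.
Proof.
move=> d0 a01 b01 ab; elim: s => [|x s IH].
  by rewrite !big_nil subrr normr0 mul0r.
rewrite !big_cons /= -natr1 mulrDl mul1r.
have -> : b x * \prod_(j <- s) b j - a x * \prod_(j <- s) a j =
    b x * (\prod_(j <- s) b j - \prod_(j <- s) a j) + (b x - a x) * \prod_(j <- s) a j by ring.
apply: (le_trans (ler_normD _ _)); rewrite !normrM lerD//.
  rewrite -[leRHS]mul1r ler_pM//.
  by have /andP[? ?] := b01 x; rewrite ger0_norm.
rewrite -[leRHS]mulr1 ler_pM//.
by have /andP[? ?] := prod01 s a01; rewrite ger0_norm.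
Qed.

(** Leibniz rule with remainder: [e] bounds the remainder of each factor, and the terms in [d ^+ 2]
    collect the products of two increments. The sum over [rem z s] differentiates one occurrence at
    a time. *)
Lemma prod_expansion (a b c : S -> R) (d e h : R) s : 0 <= d -> 0 <= e ->
  (forall x, 0 <= a x <= 1) -> (forall x, 0 <= b x <= 1) ->
  (forall x, `|b x - a x| <= d) ->
  (forall x, `|b x - a x - h * c x| <= e) ->
  `|\prod_(x <- s) b x - \prod_(x <- s) a x -
    h * \sum_(z <- s) c z * \prod_(x <- rem z s) a x| <=
  (size s)%:R * e + (size s)%:R ^+ 2 * d ^+ 2.
Proof.
move=> d0 e0 a01 b01 ab abc; elim: s => [|x s IH].
  by rewrite !big_nil mulr0 subr0 subrr normr0 !mul0r add0r mulr_ge0 ?sqr_ge0.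
have -> : \sum_(z <- x :: s) c z * \prod_(y <- rem z (x :: s)) a y =
    c x * \prod_(y <- s) a y + a x * \sum_(z <- s) c z * \prod_(y <- rem z s) a y.
  rewrite big_cons /= eqxx; congr (_ + _).
  rewrite mulr_sumr; apply: eq_big_seq => z zs.
  (* If the site [x] occurs again in the tail, [rem] deletes the head copy instead, which has the
     same factor. *)
  have [xz|_] := eqVneq x z; last by rewrite big_cons mulrCA.
  by rewrite (prod_rem _ zs) xz mulrCA.
rewrite !big_cons /=.
set pb := \prod_(j <- s) b j; set pa := \prod_(j <- s) a j.
set w := \sum_(z <- s) _.
have -> : b x * pb - a x * pa - h * (c x * pa + a x * w) =
  (b x - a x - h * c x) * pa + a x * (pb - pa - h * w) + (b x - a x) * (pb - pa) by ring.
have /andP[pa0 pa1] : 0 <= pa <= 1 := prod01 s a01.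
have /andP[ax0 ax1] := a01 x.
have n0 : (0 : R) <= (size s)%:R by [].
have h1 : `|(b x - a x - h * c x) * pa| <= e.
  by rewrite normrM -[leRHS]mulr1 ler_pM// ger0_norm.
have h2 : `|a x * (pb - pa - h * w)| <= (size s)%:R * e + (size s)%:R ^+ 2 * d ^+ 2.
  by rewrite normrM -[leRHS]mul1r ler_pM// ger0_norm.
have h3 : `|(b x - a x) * (pb - pa)| <= d * ((size s)%:R * d).
  by rewrite normrM ler_pM// prod_increment.
apply: (le_trans (ler_normD _ _)); apply: (le_trans (lerD (ler_normD _ _) (lexx _))).
apply: (le_trans (lerD (lerD h1 h2) h3)).
rewrite -natr1; set n := (size s)%:R; nra.
Qed.

End PowerProducts.

(** * Evolution of finite configurations *)

Section DynamicsOnFiniteConfigurations.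
Variables (R : realType) (m : R) (S : countType) (p : S -> S -> R).
Hypothesis m_gt0 : 0 < m.
Hypothesis p_ge0 : forall x y, 0 <= p x y.
Hypothesis p_sym : forall x y, p x y = p y x.
Hypothesis p_sum : forall x, \sum_(y \in [set: S]) p x y = 1.
Hypothesis p_diag : forall x, p x x = 0.
Variable P : R -> R.-pker config S ~> config S.
Hypothesis P_start : forall s A, measurable A -> P 0 (conf s) A = \d_(conf s) A.
Hypothesis P_markov : forall (a b : R) s A, 0 <= a -> 0 <= b -> measurable A ->
  P (a + b) (conf s) A = (\int[P a (conf s)]_zeta P b zeta A)%E.
Hypothesis P_generator : forall (s : seq S) (f : config S -> R), measurable_fun [set: config S] f ->
  (exists M : R, forall zeta, `|f zeta| <= M) ->
  half_line_derivative (fun t => \int[P t (conf s)]_zeta f zeta)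
    (fun t => \int[P t (conf s)]_zeta generator m p f zeta).
Implicit Types (f g : config S -> R) (s : seq S) (N : nat) (t h M : R).
Local Notation L := (generator m p).

(** Restricting the integral to [occ N] removes all measurability conditions on [f]. Nothing is lost
    when [eta] has [N] particles, by [kernel_setC_occ]. *)
Definition expect N t eta f : R := \int[P t eta]_(zeta in occ N) f zeta.

Definition bounded_on N M f := forall zeta, occ N zeta -> `|f zeta| <= M.

Lemma kernel_lt_pinfty t eta A : measurable A -> (P t eta A < +oo)%E.
Proof.
move=> mA; apply: (@le_lt_trans _ _ (P t eta setT)); last by rewrite prob_kernel ltry.
by apply: le_measure; rewrite ?inE.
Qed.

Lemma integrable_bounded_on N M f t eta : bounded_on N M f ->
  (P t eta).-integrable (occ N) (EFin \o f).
Proof.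
move=> fM; apply: measurable_bounded_integrable.
- exact: measurable_occ.
- by apply: kernel_lt_pinfty; exact: measurable_occ.
- exact: measurable_fun_occ.
- exists M; split; first exact: num_real.
  by move=> x Mx z zN; exact: le_trans (fM _ zN) (ltW Mx).
Qed.

Lemma EFin_expect N M t eta f : bounded_on N M f ->
  (expect N t eta f)%:E = (\int[P t eta]_(zeta in occ N) (f zeta)%:E)%E.
Proof.
move=> fM; rewrite fineK//; apply: integrable_fin_num; first exact: measurable_occ.
exact: integrable_bounded_on fM.
Qed.

Lemma expect_derivative N M f s : bounded_on N M f ->
  half_line_derivative (fun t => expect N t (conf s) f)
    (fun t => expect N t (conf s) (L f)).
Proof.
move=> fM.
have -> : (fun t => expect N t (conf s) f) =
    (fun t => \int[P t (conf s)]_zeta (f \_ (occ N)) zeta).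
  by apply/funext => t; rewrite /expect Rintegral_mkcond.
have -> : (fun t => expect N t (conf s) (L f)) =
    (fun t => \int[P t (conf s)]_zeta L (f \_ (occ N)) zeta).
  by apply/funext => t; rewrite /expect Rintegral_mkcond generator_restrict.
apply: P_generator.
  by apply/(measurable_restrictT _ (measurable_occ N)); exact: measurable_fun_occ.
(* If [occ N] is empty, [M] may be negative. *)
exists (Num.max M 0) => zeta; rewrite patchE; case: ifPn => [|_].
  by rewrite inE => /fM h; rewrite le_max h.
by rewrite normr0 le_max lexx orbT.
Qed.

Lemma expect0 N M f s : bounded_on N M f -> size s = N -> expect N 0 (conf s) f = f (conf s).
Proof.
move=> fM sN; have cN : occ N (conf s) by exists s.
rewrite /expect /Rintegral.
rewrite (@eq_measure_integral _ _ _ _ \d_(conf s)); last first.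
  by move=> A mA _; exact: P_start.
rewrite integral_dirac//; first by rewrite diracE mem_set//= mul1r.
  exact: measurable_occ.
by apply/measurable_EFinP; exact: measurable_fun_occ.
Qed.

(** Conservation of the number of particles, read off the generator: as L 1 = 0, the mass of [occ N]
    has derivative 0 in time. *)
Lemma kernel_occ N t s : size s = N -> 0 <= t -> P t (conf s) (occ N) = 1%E.
Proof.
move=> sN t0; have b1 : bounded_on N 1 (cst 1) by move=> z _; rewrite normr1.
have cE c u : expect N u (conf s) (cst c) = c * fine (P u (conf s) (occ N)).
  by rewrite /expect Rintegral_cst//; exact: measurable_occ.
have := half_line_mean_value (a := 0) (M := 0) (expect_derivative (s := s) b1) t0.
rewrite !mulr0 subr0 (expect0 b1 sN) cE mul1r => h.
have {}h : fine (P t (conf s) (occ N)) = 1.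
  apply/eqP; rewrite -subr_eq0 -normr_le0; apply: h => u _.
  by rewrite generator_cst cE mul0r subrr normr0.
rewrite -[LHS]fineK ?h// ge0_fin_numE//.
by apply: kernel_lt_pinfty; exact: measurable_occ.
Qed.

Lemma bounded_on_ge0 N M f s : bounded_on N M f -> size s = N -> 0 <= M.
Proof.
move=> fM sN; have : occ N (conf s) by exists s.
by move=> /fM; apply: le_trans.
Qed.

Lemma expect_cst N t s c : size s = N -> 0 <= t -> expect N t (conf s) (cst c) = c.
Proof.
move=> sN t0; rewrite /expect Rintegral_cst ?kernel_occ//= ?mulr1//.
exact: measurable_occ.
Qed.

Lemma eq_expect N t eta f g : (forall zeta, occ N zeta -> f zeta = g zeta) ->
  expect N t eta f = expect N t eta g.
Proof. by move=> fg; apply: eq_Rintegral => z; rewrite inE => /fg. Qed.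

Lemma expectD N M1 M2 t eta f g : bounded_on N M1 f -> bounded_on N M2 g ->
  expect N t eta (fun z => f z + g z) = expect N t eta f + expect N t eta g.
Proof.
move=> fM gM; rewrite /expect RintegralD//; first exact: measurable_occ.
  exact: integrable_bounded_on fM.
exact: integrable_bounded_on gM.
Qed.

Lemma expectB N M1 M2 t eta f g : bounded_on N M1 f -> bounded_on N M2 g ->
  expect N t eta (fun z => f z - g z) = expect N t eta f - expect N t eta g.
Proof.
move=> fM gM; rewrite /expect RintegralB//; first exact: measurable_occ.
  exact: integrable_bounded_on fM.
exact: integrable_bounded_on gM.
Qed.

Lemma expectZ N M c t eta f : bounded_on N M f ->
  expect N t eta (fun z => c * f z) = c * expect N t eta f.
Proof.
move=> fM; rewrite /expect RintegralZl//; first exact: measurable_occ.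
exact: integrable_bounded_on fM.
Qed.

Lemma le_expect N M1 M2 t eta f g : bounded_on N M1 f -> bounded_on N M2 g ->
  (forall zeta, occ N zeta -> f zeta <= g zeta) ->
  expect N t eta f <= expect N t eta g.
Proof.
move=> fM gM fg; apply: le_Rintegral => //; first exact: measurable_occ.
  exact: integrable_bounded_on fM.
exact: integrable_bounded_on gM.
Qed.

Lemma bounded_on_cst N c : bounded_on N `|c| (cst c).
Proof. by []. Qed.

Lemma bounded_on_add N M1 M2 f g : bounded_on N M1 f -> bounded_on N M2 g ->
  bounded_on N (M1 + M2) (fun z => f z + g z).
Proof. by move=> fM gM z zN; apply: (le_trans (ler_normD _ _)); rewrite lerD ?fM ?gM. Qed.

Lemma bounded_on_sub N M1 M2 f g : bounded_on N M1 f -> bounded_on N M2 g ->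
  bounded_on N (M1 + M2) (fun z => f z - g z).
Proof. by move=> fM gM z zN; apply: (le_trans (ler_normB _ _)); rewrite lerD ?fM ?gM. Qed.

Lemma bounded_on_expect N M t f : bounded_on N M f -> 0 <= t ->
  bounded_on N M (fun z => expect N t z f).
Proof.
move=> fM t0 _ [s sN <-]; rewrite ler_norml; apply/andP; split.
  rewrite -(expect_cst (- M) sN t0); apply: (le_expect _ _ (@bounded_on_cst N (- M)) fM).
  by move=> z /fM; rewrite ler_norml => /andP[].
rewrite -[leRHS](expect_cst M sN t0); apply: (le_expect _ _ fM (@bounded_on_cst N M)).
by move=> z /fM; rewrite ler_norml => /andP[].
Qed.

Lemma bounded_on_generator N M f : bounded_on N M f ->
  bounded_on N (gen_bound m N * M) (L f).
Proof. exact: generator_bounded. Qed.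

Lemma expect_first_order N M h f s : bounded_on N M f -> size s = N -> 0 <= h ->
  `|expect N h (conf s) f - f (conf s)| <= h * (gen_bound m N * M).
Proof.
move=> fM sN h0.
have := half_line_mean_value (a := 0) (M := gen_bound m N * M) (expect_derivative (s := s) fM) h0.
rewrite mulr0 subr0 (expect0 fM sN); apply => t /andP[t0 _]; rewrite subr0.
by apply: (bounded_on_expect (bounded_on_generator fM) t0); exists s.
Qed.

(** The derivative at time t is E_t (L f). Since L f is again bounded, the first-order estimate
    applies to it and bounds its deviation from the value at time 0. *)
Lemma expect_second_order N M h f s : bounded_on N M f -> size s = N -> 0 <= h ->
  `|expect N h (conf s) f - f (conf s) - h * L f (conf s)| <=
  h ^+ 2 * (gen_bound m N ^+ 2 * M).
Proof.
move=> fM sN h0.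
have := half_line_mean_value (a := L f (conf s))
  (M := h * (gen_bound m N ^+ 2 * M)) (expect_derivative (s := s) fM) h0.
rewrite (expect0 fM sN) [h * (h * _)]mulrA -expr2; apply => t /andP[t0 th].
apply: (le_trans (expect_first_order (bounded_on_generator fM) sN t0)).
rewrite [gen_bound m N * _]mulrA -expr2 ler_wpM2r//.
by rewrite mulr_ge0 ?exprn_ge0 ?gen_bound_ge0// (bounded_on_ge0 fM sN).
Qed.

Lemma kernel_setC_occ N t s : size s = N -> 0 <= t -> P t (conf s) (~` occ N) = 0%E.
Proof.
move=> sN t0; have mN := @measurable_occ S N.
have hU : P t (conf s) (occ N `|` ~` occ N) = 1%E by rewrite setUv; exact: prob_kernel.
have : (P t (conf s) (occ N) + P t (conf s) (~` occ N) = 1)%E.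
  by rewrite -hU; apply/esym/measureU => //; [exact: measurableC|exact: setICr].
rewrite (kernel_occ sN t0).
have : (0 <= P t (conf s) (~` occ N))%E by [].
case: (P t (conf s) (~` occ N)) => //= r r0 [] h.
by congr EFin; lra.
Qed.

Lemma expect_markov_ge0 N M (a b : R) s f : bounded_on N M f ->
  (forall zeta, occ N zeta -> 0 <= f zeta) ->
  size s = N -> 0 <= a -> 0 <= b ->
  expect N (a + b) (conf s) f = expect N a (conf s) (fun z => expect N b z f).
Proof.
move=> fM f0 sN a0 b0.
have mN := @measurable_occ S N.
(* The integral against a composition of kernels requires an integrand measurable on all
   configurations, hence the extension by 0. *)
pose F := (EFin \o f) \_ (occ N).
have F0 z : (0 <= F z)%E.
  by rewrite /F patchE; case: ifPn => // zN; rewrite lee_fin f0// -inE.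
have mF : measurable_fun [set: config S] F.
  by apply/(measurable_restrictT _ mN); exact: measurable_fun_occ.
apply: EFin_inj; rewrite (EFin_expect _ _ fM) integral_mkcond.
rewrite (EFin_expect _ _ (bounded_on_expect fM b0)).
under [RHS]eq_integral do rewrite (EFin_expect _ _ fM) integral_mkcond.
transitivity (\int[P a (conf s)]_y \int[P b y]_z F z)%E.
  rewrite -[RHS](integral_kcomp (P a) (kernel.kernel_snd (P b)) (conf s) F0 mF).
  by apply: eq_measure_integral => A mA _; exact: P_markov.
rewrite (@ge0_integral_full_measure _ _ _ (occ N))//=.
- exact: kernel_setC_occ.
- by move=> z; exact: integral_ge0.
- exact: measurable_fun_occ.
Qed.

(** Adding the constant [M] makes [f] nonnegative; the constant cancels because [expect] preserves
    constants. *)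
Lemma expect_markov N M (a b : R) s f : bounded_on N M f ->
  size s = N -> 0 <= a -> 0 <= b ->
  expect N (a + b) (conf s) f = expect N a (conf s) (fun z => expect N b z f).
Proof.
move=> fM sN a0 b0.
have ab0 : 0 <= a + b by rewrite addr_ge0.
have gM := bounded_on_sub fM (@bounded_on_cst N (- M)).
have := expect_markov_ge0 gM _ sN a0 b0.
rewrite (expectB _ _ fM (@bounded_on_cst N (- M))) expect_cst//.
rewrite (@eq_expect _ _ _ (fun z => expect N b z _) (fun z => expect N b z f - cst (- M) z)).
  rewrite (expectB _ _ (bounded_on_expect fM b0) (@bounded_on_cst N (- M))) expect_cst//.
  move=> /(_ _)/addIr; apply=> z /fM.
  by rewrite ler_norml => /andP[] ? _; rewrite subr_ge0.
by move=> _ [s' s'N <-]; rewrite (expectB _ _ fM (@bounded_on_cst N (- M))) expect_cst.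
Qed.

(* The local errors h^2 C add up to t^2 C / n over n steps of length h = t / n. *)
Lemma expect_subsolution N M C t (u : R -> config S -> R) s :
  0 <= C -> 0 <= t -> size s = N ->
  (forall r : R, 0 <= r <= t -> bounded_on N M (u r)) ->
  (forall (r : R) h zeta, 0 <= r -> 0 <= h -> r + h <= t -> occ N zeta ->
    u (r + h) zeta <= expect N h zeta (u r) + h ^+ 2 * C) ->
  u t (conf s) <= expect N t (conf s) (u 0).
Proof.
move=> C0 t0 sN uM step.
have bu0 : bounded_on N M (u 0) by apply: uM; rewrite lexx.
suff telescope n : (0 < n)%N ->
    u t (conf s) <= expect N t (conf s) (u 0) + t ^+ 2 * C / n%:R.
  apply/ler_addgt0Pr => e e0.
  pose n := (Num.truncn (t ^+ 2 * C / e)).+1.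
  apply: (le_trans (telescope n isT)); rewrite lerD2l ler_pdivrMr ?ltr0n//.
  by rewrite [leRHS]mulrC -ler_pdivrMr//; apply: ltW; exact: truncnS_gt.
move=> n0; pose h := t / n%:R.
have nn0 : 0 < n%:R :> R by rewrite ltr0n.
have h0 : 0 <= h by rewrite divr_ge0.
have nh : n%:R * h = t by rewrite mulrC divfK// gt_eqF.
have -> : t ^+ 2 * C / n%:R = n%:R * (h ^+ 2 * C).
  by rewrite /h; field; rewrite gt_eqF.
rewrite -{1 2}nh.
have : (n <= n)%N by [].
(* Induction on the number k of steps, for all starting lists at once: [step] accounts for the last
   increment of [u], and the induction hypothesis is integrated at time [h] through the Markov
   property. *)
elim: {-2}n s sN => [|k IH] s sN kn.
  by rewrite !mul0r addr0 (expect0 bu0 sN).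
have kh0 : 0 <= k%:R * h by rewrite mulr_ge0.
have kht : k%:R * h + h <= t.
  have : k.+1%:R * h <= n%:R * h by rewrite ler_wpM2r// ler_nat.
  by rewrite nh -natr1 mulrDl mul1r.
rewrite -natr1 (mulrDl _ _ h) mul1r.
have cs : occ N (conf s) by exists s.
apply: (le_trans (step _ _ _ kh0 h0 kht cs)).
rewrite [_ * h + h]addrC (expect_markov bu0 sN h0 kh0) [(_ + 1) * _]mulrDl mul1r addrA lerD2r.
have bE := bounded_on_expect bu0 kh0.
have cN := @bounded_on_cst N (k%:R * (h ^+ 2 * C)).
rewrite -[X in _ <= _ + X](expect_cst _ sN h0) -(expectD _ _ bE cN).
apply: le_expect.
- by apply: uM; rewrite kh0/=; lra.
- move=> z zN; apply: (le_trans (ler_normD _ _)); apply: lerD; first exact: bE.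
  exact: cN.
- by move=> _ [s' s'N <-]; apply: IH => //; exact: ltnW.
Qed.

(** * Comparison with independent walkers *)

Lemma sum_count (Y s : seq S) (h : S -> R) : uniq Y -> {subset s <= Y} ->
  \sum_(y <- Y) (count_mem y s)%:R * h y = \sum_(w <- s) h w.
Proof.
move=> uY; elim: s => [|a s IH] sY.
  by rewrite big_nil big1// => y _; rewrite mul0r.
rewrite big_cons -IH; last by move=> x xs; rewrite sY// inE xs orbT.
have -> : h a = \sum_(y <- Y) (a == y)%:R * h y.
  rewrite (bigD1_seq a) ?sY ?mem_head//= eqxx mul1r big1 ?addr0// => y.
  by rewrite eq_sym => /negbTE ->; rewrite mul0r.
by rewrite -big_split; apply: eq_bigr => y _ /=; rewrite natrD mulrDl.
Qed.

(* Symmetrizing the attraction term in (z, w) leaves a multiple of (g z - g w)^2. *)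
Lemma attraction_ge0 (g : S -> R) s : (forall x, 0 <= g x) ->
  0 <= \sum_(z <- s) \sum_(w <- s) p z w * (g w - g z) * \prod_(x <- rem z s) g x.
Proof.
move=> g0; set T := \sum_(z <- s) _.
have TT : T + T = \sum_(z <- s) \sum_(w <- s)
  (p z w * (g w - g z) * \prod_(x <- rem z s) g x +
   p w z * (g z - g w) * \prod_(x <- rem w s) g x).
  under eq_bigr do rewrite big_split; rewrite big_split /=; congr (_ + _).
  by rewrite /T exchange_big.
suff h : 0 <= T + T by lra.
rewrite TT big_seq; apply: sumr_ge0 => z zs.
rewrite [X in 0 <= X]big_seq; apply: sumr_ge0 => w ws.
have [<-|zw] := eqVneq z w; first by rewrite p_diag !mul0r addr0.
have wz : w \in rem z s by rewrite rem_mem// eq_sym.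
have zw' : z \in rem w s by rewrite rem_mem.
have rem_comm : perm_eq (rem w (rem z s)) (rem z (rem w s)).
  by apply/allP => x _ /=; rewrite !count_mem_rem subnAC.
rewrite (prod_rem _ wz) (prod_rem _ zw') (perm_big _ rem_comm) p_sym.
set q := \prod_(j <- _) _; have q0 : 0 <= q by exact: prodr_ge0.
have -> : p w z * (g w - g z) * (g w * q) + p w z * (g z - g w) * (g z * q) =
  p w z * q * (g w - g z) ^+ 2 by ring.
by rewrite mulr_ge0 ?sqr_ge0 ?mulr_ge0.
Qed.

(** The part 2m of the rate 2 (m + 2 count) moves the particles independently and acts on the
    product as a derivation, which gives the left side. In the remaining part, the count turns the
    sum over target sites into a sum over particles, which is the attraction term. *)
Lemma generator_power_product (g : S -> R) s : (forall x, 0 <= g x) ->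
  \sum_(z <- s) L (power_product g) (conf [:: z]) * \prod_(x <- rem z s) g x
  <= L (power_product g) (conf s).
Proof.
move=> g0; have [Y [cY sY]] := exists_covers p_sum s.
have uY : uniq Y by case: cY.
rewrite (generator_conf _ _ cY).
have -> : \sum_(z <- s) L (power_product g) (conf [:: z]) * \prod_(x <- rem z s) g x =
    \sum_(z <- s) \sum_(y <- Y) p z y * (2 * m) * (g y - g z) * \prod_(x <- rem z s) g x.
  apply: eq_big_seq => z zs; rewrite -mulr_suml; congr (_ * _).
  have cz : covers p Y [:: z].
    by split=> // x; rewrite inE => /eqP ->; case: cY => _; apply.
  rewrite (generator_conf _ _ cz) big_seq1; apply: eq_bigr => y _.
  rewrite /= eqxx !power_product_conf !big_seq1.
  (* A lone particle is attracted only by itself, at [y = z], where [p] vanishes. *)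
  by have [->|zy] := eqVneq z y; rewrite ?p_diag /=; ring.
rewrite -subr_ge0 -sumrB.
have -> : \sum_(z <- s) (\sum_(y <- Y) p z y * (2 * (m + 2 * (count_mem y s)%:R)) *
   (power_product g (conf (y :: rem z s)) - power_product g (conf s)) -
   \sum_(y <- Y) p z y * (2 * m) * (g y - g z) * \prod_(x <- rem z s) g x) =
   4 * \sum_(z <- s) \sum_(w <- s) p z w * (g w - g z) * \prod_(x <- rem z s) g x.
  rewrite mulr_sumr; apply: eq_big_seq => z zs.
  rewrite -sumrB -(sum_count _ uY sY) mulr_sumr; apply: eq_bigr => y _.
  by rewrite !power_product_conf big_cons (prod_rem _ zs); ring.
by rewrite mulr_ge0// attraction_ge0.
Qed.

Lemma power_product_bounded_on N (g : S -> R) : (forall x, 0 <= g x <= 1) ->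
  bounded_on N 1 (power_product g).
Proof.
move=> g01 _ [s _ <-]; rewrite power_product_conf.
by have /andP[p0 p1] := prod01 s g01; rewrite ger0_norm.
Qed.

(** The left side is u_t(s) for u_r = [power_product (G r)]. One step of the subsolution estimate
    combines the expansion of the product, [generator_power_product], and the expansion of the
    [N]-particle expectation. *)
Lemma comparison_unit (g : S -> R) s (t : R) : (forall x, 0 <= g x <= 1) -> 0 <= t ->
  \prod_(z <- s) expect 1 t (conf [:: z]) (power_product g)
  <= expect (size s) t (conf s) (power_product g).
Proof.
move=> g01 t0.
pose G r z := expect 1 r (conf [:: z]) (power_product g).
have G01 r : 0 <= r -> forall z, 0 <= G r z <= 1.
  move=> r0 z; apply/andP; split.
    apply: Rintegral_ge0 => _ [s' _ <-]; rewrite power_product_conf.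
    by have /andP[] := prod01 s' g01.
  have := bounded_on_expect (power_product_bounded_on (N := 1) g01) r0.
  move=> /(_ (conf [:: z])) h; apply: (le_trans (ler_norm _)); apply: h; by exists [:: z].
have Gstep r h z : 0 <= r -> 0 <= h ->
    G (r + h) z = expect 1 h (conf [:: z]) (power_product (G r)).
  move=> r0 h0; rewrite /G addrC.
  rewrite (expect_markov (power_product_bounded_on (N := 1) g01))//.
  apply: eq_expect => _ [[|x []]//= _ <-].
  by rewrite power_product_conf big_seq1.
have G0 : G 0 = g.
  apply/funext => z; rewrite /G (expect0 (power_product_bounded_on (N := 1) g01))//.
  by rewrite power_product_conf big_seq1.
pose B1 := gen_bound m 1; pose BN := gen_bound m (size s); pose n : R := (size s)%:R.
have B10 : 0 <= B1 := gen_bound_ge0 m_gt0 1.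
have n0 : 0 <= n by exact: ler0n.
(* The three terms of C: the second-order error of the process from [s], the second-order errors of
   the n one-particle factors, and the products of two of their increments. *)
have C0 : 0 <= BN ^+ 2 + n * B1 ^+ 2 + n ^+ 2 * B1 ^+ 2.
  have s1 := sqr_ge0 BN; have s2 := sqr_ge0 B1.
  by rewrite addr_ge0 ?addr_ge0 ?(mulr_ge0 n0)// mulr_ge0// sqr_ge0.
have := @expect_subsolution (size s) 1 _ t (fun r => power_product (G r)) s C0 t0 erefl.
rewrite G0 power_product_conf; apply.
  by move=> r /andP[r0 _]; exact: power_product_bounded_on (G01 r r0).
move=> r h _ r0 h0 rht [s' s's <-].
have rh0 : 0 <= r + h by rewrite addr_ge0.
have bG := power_product_bounded_on (N := 1) (G01 r r0).
have bGN := power_product_bounded_on (N := size s) (G01 r r0).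
have GE z : power_product (G r) (conf [:: z]) = G r z by rewrite power_product_conf big_seq1.
have first z : `|G (r + h) z - G r z| <= h * B1.
  rewrite Gstep// -[X in _ - X]GE.
  by apply: (le_trans (expect_first_order bG _ h0)) => //; rewrite mulr1.
have second z : `|G (r + h) z - G r z - h * L (power_product (G r)) (conf [:: z])| <=
    h ^+ 2 * B1 ^+ 2.
  rewrite Gstep// -[X in _ - X - _]GE.
  by apply: (le_trans (expect_second_order bG _ h0)) => //; rewrite mulr1.
have := prod_expansion s' _ _ (G01 r r0) (G01 _ rh0) first second.
rewrite s's -/n => /(_ (mulr_ge0 h0 B10) (mulr_ge0 (sqr_ge0 h) (sqr_ge0 B1))) expansion.
have := @generator_power_product (G r) s' (fun x => proj1 (andP (G01 r r0 x))).
have := expect_second_order bGN s's h0; rewrite mulr1 -/BN.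
rewrite !power_product_conf.
set pa := \prod_(x <- s') G r x in expansion *.
set pb := \prod_(x <- s') G (r + h) x in expansion *.
set W := \sum_(z <- s') _ in expansion *.
move=> hE hL.
have hLh : h * W <= h * L (power_product (G r)) (conf s') by rewrite ler_wpM2l.
move: expansion hE; rewrite !ler_norml => /andP[_ e1] /andP[e2 _].
lra.
Qed.

(* [g] is rescaled into [0, 1], both sides being homogeneous of degree [size s] *)
Lemma comparison (g : S -> R) (M : R) s (t : R) : (forall x, 0 <= g x <= M) -> 0 <= t ->
  \prod_(z <- s) expect 1 t (conf [:: z]) (power_product g)
  <= expect (size s) t (conf s) (power_product g).
Proof.
move=> gM t0; pose c := Num.max M 1.
have c0 : 0 < c by rewrite lt_max ltr01 orbT.
pose g1 x := g x / c.
have g101 x : 0 <= g1 x <= 1.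
  have /andP[g0 gx] := gM x.
  by rewrite divr_ge0 ?(ltW c0)//= ler_pdivrMr// mul1r le_max gx.
have gE : g = (fun x => c * g1 x).
  by apply/funext => x; rewrite /g1 mulrC divfK// gt_eqF.
have scale N eta : expect N t eta (power_product g) = c ^+ N * expect N t eta (power_product g1).
  rewrite -(expectZ _ _ _ (power_product_bounded_on (N := N) g101)).
  by apply: eq_expect => _ [s' <- <-]; rewrite gE power_productZ.
rewrite scale; under eq_bigr do rewrite scale.
rewrite big_split/= big_const_seq count_predT iter_mulr_1 expr1.
by rewrite ler_wpM2l ?exprn_ge0 ?(ltW c0)// comparison_unit.
Qed.

(** Truncating [g] at height n makes [comparison] applicable; both sides then converge
    monotonically. The limits on the left may be infinite, which is why [prode_lim_le] is used. *)
Lemma comparison_integral (g : S -> R) s (t : R) : (forall x, 0 <= g x) -> 0 <= t ->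
  (\prod_(z <- s) \int[P t (conf [:: z])]_(zeta in occ 1) (power_product g zeta)%:E
   <= \int[P t (conf s)]_(zeta in occ (size s)) (power_product g zeta)%:E)%E.
Proof.
move=> g0 t0; pose gn (n : nat) x := Num.min (g x) n%:R.
have gn0 n x : 0 <= gn n x by rewrite le_min g0 ler0n.
have gnM n x : 0 <= gn n x <= n%:R by rewrite gn0 ge_min lexx orbT.
have pp0 (h : S -> R) zeta N : (forall x, 0 <= h x) -> occ N zeta -> 0 <= power_product h zeta.
  by move=> h0 [s' _ <-]; rewrite power_product_conf prodr_ge0.
have pp_le (h1 h2 : S -> R) zeta N : (forall x, 0 <= h1 x <= h2 x) -> occ N zeta ->
    power_product h1 zeta <= power_product h2 zeta.
  by move=> h12 [s' _ <-]; rewrite !power_product_conf ler_prod.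
have pp_bounded n N : bounded_on N (n%:R ^+ N) (power_product (gn n)).
  move=> _ [s' <- <-]; rewrite power_product_conf ger0_norm; last exact: prodr_ge0.
  have -> : n%:R ^+ size s' = \prod_(x <- s') n%:R :> R.
    by rewrite big_const_seq count_predT iter_mulr_1.
  by apply: ler_prod => x _.
have gn_cvg x : gn n x @[n --> \oo] --> g x.
  apply: cvg_near_cst; near=> n; rewrite /gn min_l//.
  apply: (le_trans (ltW (truncnS_gt _))); rewrite ler_nat; near: n.
  exact: nbhs_infty_ge.
have prod_cvg s' : \prod_(x <- s') gn n x @[n --> \oo] --> \prod_(x <- s') g x.
  elim: s' => [|x s' IH].
    by rewrite big_nil; under eq_fun do rewrite big_nil; exact: cvg_cst.
  by rewrite big_cons; under eq_fun do rewrite big_cons; exact: cvgM.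
have int_cvg N eta :
    (\int[P t eta]_(zeta in occ N) (power_product (gn n) zeta)%:E)%E @[n --> \oo] -->
    (\int[P t eta]_(zeta in occ N) (power_product g zeta)%:E)%E.
  rewrite (@eq_integral _ _ _ _ (occ N)
    (fun zeta => limn (fun n => (power_product (gn n) zeta)%:E)) (EFin \o power_product g)).
    apply: cvg_monotone_convergence.
    - exact: measurable_occ.
    - by move=> n; exact: measurable_fun_occ.
    - by move=> n zeta zN; rewrite lee_fin (pp0 _ _ N).
    - move=> zeta zN n1 n2 n12; rewrite lee_fin (pp_le _ _ _ N)// => x.
      by rewrite gn0 /= le_min !ge_min lexx /= ler_nat n12 orbT.
  move=> zeta; rewrite inE => -[s' _ <-]; apply/esym/cvg_lim => //.
  apply: cvg_EFin; first exact: nearW.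
  rewrite /= power_product_conf; under eq_fun do rewrite power_product_conf.
  exact: prod_cvg.
apply: (@prode_lim_le _ _ s (fun z n =>
    \int[P t (conf [:: z])]_(zeta in occ 1) (power_product (gn n) zeta)%:E)%E).
- by move=> z n; apply: integral_ge0 => zeta zN; rewrite lee_fin (pp0 _ _ 1%N).
- by move=> z; exact: int_cvg.
move=> n.
under eq_bigr do rewrite -(EFin_expect _ _ (pp_bounded n 1%N)).
rewrite prodEFin; apply: (@le_trans _ _ (expect (size s) t (conf s) (power_product (gn n)))%:E).
  by rewrite lee_fin; exact: (comparison s (gnM n) t0).
rewrite (EFin_expect _ _ (pp_bounded n _)).
apply: ge0_le_integral.
- exact: measurable_occ.
- by move=> zeta zN; rewrite lee_fin (pp0 _ _ (size s)).
- exact: measurable_fun_occ.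
- exact: measurable_fun_occ.
- move=> zeta zN; rewrite lee_fin (pp_le _ _ _ (size s))// => x.
  by rewrite gn0 ge_min lexx.
Unshelve. all: by end_near. Qed.

(** * Self-duality on finite sets of sites *)

Lemma bounded_on_sum (I : eqType) (r : seq I) N (B : I -> R) (F : I -> config S -> R) :
  (forall i, i \in r -> bounded_on N (B i) (F i)) ->
  bounded_on N (\sum_(i <- r) B i) (fun z => \sum_(i <- r) F i z).
Proof.
move=> FB z zN; apply: (le_trans (ler_norm_sum _ _ _)).
by rewrite !big_seq; apply: ler_sum => i ir; exact: FB.
Qed.

Lemma expect_sum (I : eqType) (r : seq I) N (B : I -> R) (F : I -> config S -> R) t s :
  size s = N -> 0 <= t -> (forall i, i \in r -> bounded_on N (B i) (F i)) ->
  expect N t (conf s) (fun z => \sum_(i <- r) F i z) =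
  \sum_(i <- r) expect N t (conf s) (F i).
Proof.
move=> sN t0; elim: r => [|i r IH] FB.
  rewrite big_nil -[RHS](expect_cst 0 sN t0); apply: eq_expect => z _.
  by rewrite big_nil.
have FBr j : j \in r -> bounded_on N (B j) (F j) by move=> jr; apply: FB; rewrite inE jr orbT.
rewrite big_cons -IH// -(expectD _ _ (FB i (mem_head _ _)) (bounded_on_sum FBr)).
by apply: eq_expect => z _; rewrite big_cons.
Qed.

(** At a finite configuration the generator is a finite linear combination of evaluations, hence it
    commutes with the expectation over the other variable. *)
Lemma generator_expect N M (H : config S -> config S -> R) t s s' :
  (forall eta, occ (size s') eta -> bounded_on N M (H ^~ eta)) ->
  size s = N -> 0 <= t ->
  L (fun eta => expect N t (conf s) (H ^~ eta)) (conf s') =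
  expect N t (conf s) (fun zeta => L (H zeta) (conf s')).
Proof.
move=> HM sN t0; have [Y [cY _]] := exists_covers p_sum s'.
rewrite (generator_conf _ _ cY).
have s'N : occ (size s') (conf s') by exists s'.
have mvN z y : z \in s' -> occ (size s') (conf (y :: rem z s')).
  by move=> zs; rewrite -(move_conf _ zs) move_occ// -conf_count.
pose k z y := p z y * (2 * (m + 2 * (count_mem y s')%:R)).
pose F z y zeta := k z y * (H zeta (conf (y :: rem z s')) - H zeta (conf s')).
have bF z y : z \in s' -> bounded_on N (`|k z y| * (M + M)) (F z y).
  move=> zs zeta zN; rewrite normrM ler_wpM2l//.
  exact: (bounded_on_sub (HM _ (mvN z y zs)) (HM _ s'N)).
transitivity (expect N t (conf s) (fun zeta => \sum_(z <- s') \sum_(y <- Y) F z y zeta)).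
  rewrite (@expect_sum _ s' N (fun z => \sum_(y <- Y) `|k z y| * (M + M)))//; last first.
    by move=> z zs; apply: bounded_on_sum => y _; exact: bF.
  apply: eq_big_seq => z zs.
  rewrite (@expect_sum _ Y N (fun y => `|k z y| * (M + M)))//; last by move=> y _; exact: bF.
  apply: eq_bigr => y _.
  rewrite (expectZ _ _ _ (bounded_on_sub (HM _ (mvN z y zs)) (HM _ s'N))).
  by rewrite (expectB _ _ (HM _ (mvN z y zs)) (HM _ s'N)).
by apply: eq_expect => zeta _; rewrite (generator_conf _ _ cY).
Qed.

(** For u_r(eta) = E_xi H(xi_r, eta), the derivative in r is the expectation of L acting on the
    first argument, hence on the second, that is L u_r. So u solves the evolution equation of the
    process in eta. *)
Lemma duality_le M (H : config S -> config S -> R) s s' t :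
  (forall xi eta, occ (size s) xi -> occ (size s') eta -> 0 <= H xi eta <= M) ->
  (forall xi eta, occ (size s) xi -> occ (size s') eta -> L (H ^~ eta) xi = L (H xi) eta) ->
  0 <= t ->
  expect (size s) t (conf s) (H ^~ (conf s')) <= expect (size s') t (conf s') (H (conf s)).
Proof.
move=> HM HL t0; set N := size s; set N' := size s'.
have sN : occ N (conf s) by exists s.
have s'N : occ N' (conf s') by exists s'.
have M0 : 0 <= M by have /andP[] := HM _ _ sN s'N; exact: le_trans.
have bH eta : occ N' eta -> bounded_on N M (H ^~ eta).
  by move=> eN xi xN; have /andP[? ?] := HM _ _ xN eN; rewrite ger0_norm.
pose u r eta := expect N r (conf s) (H ^~ eta).
have bu r : 0 <= r -> bounded_on N' M (u r).
  by move=> r0 eta /bH b; exact: (bounded_on_expect b r0).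
have u0 : expect N' t (conf s') (u 0) = expect N' t (conf s') (H (conf s)).
  by apply: eq_expect => eta /bH b; rewrite /u (expect0 b).
rewrite -u0; pose C := gen_bound m N ^+ 2 * M; pose C' := gen_bound m N' ^+ 2 * M.
have C0 : 0 <= C by rewrite mulr_ge0 ?sqr_ge0.
have C'0 : 0 <= C' by rewrite mulr_ge0 ?sqr_ge0.
apply: (@expect_subsolution N' M (C + C') t u s') => //; first exact: addr_ge0.
  by move=> r /andP[r0 _]; exact: bu.
move=> r h _ r0 h0 rht [s2 s2N <-].
have eN : occ N' (conf s2) by exists s2.
have b := bH _ eN.
have bL := bounded_on_generator b.
(* The Markov property at time [r] leaves a last interval of length [h], which is expanded under the
   expectation; [HL] then moves L to the second argument. *)
have first : u (r + h) (conf s2) <= u r (conf s2) + h * L (u r) (conf s2) + h ^+ 2 * C.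
  rewrite /u (expect_markov b erefl r0 h0).
  rewrite (@generator_expect N M)//; last by rewrite s2N.
  have -> : expect N r (conf s) (fun zeta => L (H zeta) (conf s2)) =
      expect N r (conf s) (L (H ^~ (conf s2))).
    by apply: eq_expect => zeta zN; rewrite HL.
  have bc := @bounded_on_cst N (h ^+ 2 * C).
  have bhL : bounded_on N (h * (gen_bound m N * M)) (fun z => h * L (H ^~ (conf s2)) z).
    by move=> z zN; rewrite normrM (ger0_norm h0) ler_wpM2l// bL.
  have bs : bounded_on N (M + h * (gen_bound m N * M))
      (fun z => H z (conf s2) + h * L (H ^~ (conf s2)) z).
    exact: bounded_on_add b bhL.
  rewrite -(expectZ _ _ _ bL) -(expectD _ _ b bhL).
  rewrite -[X in _ <= _ + X](expect_cst _ (erefl N) r0) -(expectD _ _ bs bc).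
  apply: le_expect.
  - exact: (bounded_on_expect b h0).
  - exact: bounded_on_add bs bc.
  - move=> _ [s3 s3N <-]; have := expect_second_order b s3N h0.
    by rewrite ler_norml -/C => /andP[_]; rewrite /cst; lra.
have := expect_second_order (bu r r0) s2N h0.
by rewrite ler_norml -/C' => /andP[h1 _]; lra.
Qed.

(** The hypotheses are symmetric in the two arguments of [H], so exchanging them gives the opposite
    inequality. *)
Lemma duality_eq M (H : config S -> config S -> R) s s' t :
  (forall xi eta, occ (size s) xi -> occ (size s') eta -> 0 <= H xi eta <= M) ->
  (forall xi eta, occ (size s) xi -> occ (size s') eta -> L (H ^~ eta) xi = L (H xi) eta) ->
  0 <= t ->
  expect (size s) t (conf s) (H ^~ (conf s')) = expect (size s') t (conf s') (H (conf s)).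
Proof.
move=> HM HL t0; apply/eqP; rewrite eq_le (duality_le HM HL t0)/=.
apply: (@duality_le M (fun a b => H b a)) => //.
- by move=> xi eta xN eN; exact: HM.
- by move=> xi eta xN eN; rewrite HL.
Qed.

End DynamicsOnFiniteConfigurations.

(** * Duality functions *)

Section DualityFunctions.
Variables (R : realType) (m : R).
Hypothesis m_gt0 : 0 < m.
Implicit Types (k l : nat).
Local Notation d := (duality1 m).

Let a_gt0 : 0 < m / 2. Proof. by rewrite divr_gt0. Qed.

Lemma Gamma_ratioS k :
  (m / 2 + k%:R) * (Gamma (m / 2) / Gamma (m / 2 + k.+1%:R)) =
  Gamma (m / 2) / Gamma (m / 2 + k%:R).
Proof.
have ak : 0 < m / 2 + k%:R by rewrite ltr_pwDl.
rewrite -(natr1 k) addrA GammaS//; have := Gamma_gt0 ak => g0.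
set u := m / 2 + k%:R in ak g0 *; move: (Gamma u) (Gamma (m / 2)) g0 => G1 G2 g0.
by field; rewrite !gt_eqF.
Qed.

(** The falling factorial vanishes for [k > l], which absorbs the case distinction. *)
Lemma duality1E k l :
  d k l = (l ^_ k)%:R * (Gamma (m / 2) / Gamma (m / 2 + k%:R)).
Proof.
rewrite /duality1; case: ifPn => kl; last by rewrite ffact_small ?mul0r// ltnNge.
congr (_ * _); by rewrite -(ffact_fact kl) natrM mulfK// pnatr_eq0 -lt0n fact_gt0.
Qed.

Lemma duality1_ge0 k l : 0 <= d k l.
Proof.
rewrite duality1E mulr_ge0// divr_ge0// ltW// Gamma_gt0//.
by rewrite ltr_pwDl.
Qed.

Lemma duality10 l : d 0 l = 1.
Proof. by rewrite duality1E ffactn0 mul1r addr0 divff// gt_eqF// Gamma_gt0. Qed.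

Lemma duality1S0 k : d k.+1 0 = 0.
Proof. by rewrite /duality1. Qed.

Lemma duality1S k l : (m / 2 + k%:R) * d k.+1 l = (l%:R - k%:R) * d k l.
Proof.
rewrite !duality1E mulrCA Gamma_ratioS [RHS]mulrA; congr (_ * _).
have [kl|lk] := leqP k l; first by rewrite ffactnSr natrM natrB// mulrC.
by rewrite !ffact_small ?mulr0// ltnW.
Qed.

Lemma duality1SS k l : (m / 2 + k%:R) * d k.+1 l.+1 = l.+1%:R * d k l.
Proof. by rewrite !duality1E mulrCA Gamma_ratioS ffactSS natrM mulrA. Qed.

Lemma duality1_pred k l : l%:R * d k l.-1 = (l%:R - k%:R) * d k l.
Proof.
case: l => [|l] /=; rewrite !duality1E.
  by case: k => [|k]; rewrite ?subrr ?ffact0n ?mul0r// mulr0.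
rewrite [LHS]mulrA [RHS]mulrA; congr (_ * _).
have [kl|lk] := leqP k l.+1; last by rewrite !ffact_small ?mulr0// ltnW.
by rewrite -natrB// -!natrM -ffactSS ffactnSr mulnC.
Qed.

(** The difference in [l] lowers [k], as a derivative does. At [k = 0] the convention [0.-1 = 0] is
    harmless because of the factor [k]. *)
Lemma duality1_succ k l :
  (m / 2 + k%:R - 1) * (d k l.+1 - d k l) = k%:R * d k.-1 l.
Proof.
case: k => [|k] /=; first by rewrite !duality10 subrr mulr0 mul0r.
have -> : m / 2 + k.+1%:R - 1 = m / 2 + k%:R by rewrite -natr1; ring.
rewrite !duality1E -mulrBl mulrCA Gamma_ratioS [RHS]mulrA; congr (_ * _).
rewrite ffactSS ffactnSr; have [kl|lk] := leqP k l.
  rewrite !natrM natrB// -!natr1; ring.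
by rewrite !ffact_small ?muln0 ?mul0n ?subrr ?mulr0// ltnW.
Qed.

Lemma duality1_succ_ratio k l :
  (l%:R - k%:R + 1) * (d k l.+1 - d k l) = k%:R * d k l.
Proof.
have := duality1_pred k l.+1; rewrite /= -natr1 => h.
have -> : (l%:R - k%:R + 1) * (d k l.+1 - d k l) =
  (l%:R + 1 - k%:R) * d k l.+1 - (l%:R - k%:R + 1) * d k l by ring.
by rewrite -h; ring.
Qed.

(** With [e] for d(k, l), the letters [x], [y], [z] stand for d(k-1, l), d(k+1, l), d(k, l-1), and
    [w] for d(k, l+1) - d(k, l); primes mark the second site. The relations are not divided out
    because [a + k - 1] and [l - k + 1] may vanish. *)
Lemma two_site_algebra (a k k' l l' e e' w w' x x' y y' z z' : R) :
  (a + k) * y = (l - k) * e -> (a + k') * y' = (l' - k') * e' ->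
  l * z = (l - k) * e -> l' * z' = (l' - k') * e' ->
  (a + k - 1) * w = k * x -> (a + k' - 1) * w' = k' * x' ->
  (l - k + 1) * w = k * e -> (l' - k' + 1) * w' = k' * e' ->
  k * (a + k') * (x * y' - e * e') + k' * (a + k) * (y * x' - e * e') =
  l * (a + l') * (z * (e' + w') - e * e') + l' * (a + l) * ((e + w) * z' - e * e').
Proof.
move=> hy hy' hz hz' hx hx' hw hw'.
transitivity ((k * x) * ((a + k') * y') - k * (a + k') * (e * e')
  + ((k' * x') * ((a + k) * y) - k' * (a + k) * (e * e'))); first by ring.
rewrite hy hy' -hx -hx'.
transitivity ((l * z) * ((a + l') * (e' + w')) - l * (a + l') * (e * e')
  + ((l' * z') * ((a + l) * (e + w)) - l' * (a + l) * (e * e'))); last by ring.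
rewrite hz hz'; apply/eqP; rewrite -subr_eq0; apply/eqP.
transitivity (- (((l - k + 1) * w - k * e) * (e' * (l' - k')) +
   ((l' - k' + 1) * w' - k' * e') * (e * (l - k)))); first by ring.
by rewrite hw hw' !subrr !mul0r addr0 oppr0.
Qed.

(** Duality for the jumps across a single bond in both directions, with the rates 2k (m + 2k')
    divided by 4. *)
Lemma two_site_duality k k' l l' :
  k%:R * (m / 2 + k'%:R) * (d k.-1 l * d k'.+1 l' - d k l * d k' l') +
  k'%:R * (m / 2 + k%:R) * (d k.+1 l * d k'.-1 l' - d k l * d k' l') =
  l%:R * (m / 2 + l'%:R) * (d k l.-1 * d k' l'.+1 - d k l * d k' l') +
  l'%:R * (m / 2 + l%:R) * (d k l.+1 * d k' l'.-1 - d k l * d k' l').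
Proof.
have -> : d k l.+1 = d k l + (d k l.+1 - d k l) by rewrite addrC subrK.
have -> : d k' l'.+1 = d k' l' + (d k' l'.+1 - d k' l') by rewrite addrC subrK.
apply: two_site_algebra.
- exact: duality1S.
- exact: duality1S.
- exact: duality1_pred.
- exact: duality1_pred.
- exact: duality1_succ.
- exact: duality1_succ.
- exact: duality1_succ_ratio.
- exact: duality1_succ_ratio.
Qed.

End DualityFunctions.

(** * Duality of the generator on a finite set of sites *)

Section FiniteSelfDuality.
Variables (R : realType) (m : R) (T : finType) (p : T -> T -> R).
Hypothesis m_gt0 : 0 < m.
Hypothesis p_sym : forall x y, p x y = p y x.
Hypothesis p_diag : forall x, p x x = 0.
Implicit Types (xi eta : config T).
Local Notation d := (duality1 m).
Local Notation L := (generator m p).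

Lemma big_finite_support (op : Monoid.com_law (1 : R)) (F : T -> R) :
  \big[op/1]_(x \in [set: T]) F x = \big[op/1]_(x : T) F x.
Proof.
rewrite (fsbigE (index_enum T)) ?index_enum_uniq//; last by move=> i _; rewrite mem_index_enum.
by apply: eq_bigl => i; rewrite in_setT.
Qed.

Lemma dualityE_finite xi eta : duality m xi eta = \prod_(x : T) d (xi x) (eta x).
Proof. exact: big_finite_support. Qed.

Lemma generatorE_finite f eta : L f eta = \sum_(x : T) \sum_(y : T)
  p x y * (2 * (eta x)%:R * (m + 2 * (eta y)%:R)) * (f (move x y eta) - f eta).
Proof.
rewrite /generator (fsbigE (index_enum (T * T)%type)) ?index_enum_uniq//; last first.
  by move=> i _; rewrite mem_index_enum.
under eq_bigl do rewrite in_setT.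
by rewrite pair_bigA.
Qed.

Lemma sum_antisymmetric (U : T -> T -> R) :
  (forall x y, U x y + U y x = 0) -> \sum_(x : T) \sum_(y : T) U x y = 0.
Proof.
move=> hU; set Z := \sum_(x : T) _.
have : Z + Z = 0.
  rewrite {2}/Z exchange_big -big_split big1//= => x _.
  by rewrite -big_split big1//= => y _; exact: hU.
lra.
Qed.

Lemma prod_split2 (F : T -> R) x y : x != y ->
  \prod_z F z = F x * F y * \prod_(z | (z != x) && (z != y)) F z.
Proof. by move=> xy; rewrite (bigD1 x)//= (bigD1 y) 1?eq_sym//= mulrA. Qed.

(** The two sides agree bond by bond: in their difference, the terms of (x, y) and (y, x) cancel by
    [two_site_duality], although neither need vanish alone. *)
Lemma generator_duality xi eta :
  L (fun zeta => duality m zeta eta) xi = L (duality m xi) eta.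
Proof.
apply/eqP; rewrite -subr_eq0 !generatorE_finite -sumrB; apply/eqP.
under eq_bigr do rewrite -sumrB.
apply: sum_antisymmetric => x y.
have [<-|xy] := eqVneq x y; first by rewrite p_diag !mul0r subrr addr0.
pose q := \prod_(z | (z != x) && (z != y)) d (xi z) (eta z).
have split2 (xi' eta' : config T) k k' l l' :
    xi' x = k -> xi' y = k' -> eta' x = l -> eta' y = l' ->
    (forall z, (z != x) && (z != y) -> xi' z = xi z) ->
    (forall z, (z != x) && (z != y) -> eta' z = eta z) ->
    duality m xi' eta' = d k l * d k' l' * q.
  move=> <- <- <- <- hxi heta.
  rewrite dualityE_finite (prod_split2 _ xy); congr (_ * _).
  by apply: eq_bigr => z zz; rewrite hxi// heta.
have mvx (zeta : config T) : move x y zeta x = (zeta x).-1.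
  by rewrite /move eqxx (negbTE xy) addn0 subn1.
have mvy (zeta : config T) : move x y zeta y = (zeta y).+1.
  by rewrite /move eqxx eq_sym (negbTE xy) subn0 addn1.
have mvx' (zeta : config T) : move y x zeta x = (zeta x).+1.
  by rewrite /move eqxx (negbTE xy) subn0 addn1.
have mvy' (zeta : config T) : move y x zeta y = (zeta y).-1.
  by rewrite /move eqxx eq_sym (negbTE xy) addn0 subn1.
have mvz a b (zeta : config T) z : (z != a) && (z != b) -> move a b zeta z = zeta z.
  by move=> /andP[/negbTE za /negbTE zb]; rewrite /move za zb subn0 addn0.
have id (zeta : config T) z : (z != x) && (z != y) -> zeta z = zeta z by [].
have mv (zeta : config T) := @mvz x y zeta.
have mv' (zeta : config T) z : (z != x) && (z != y) -> move y x zeta z = zeta z.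
  by move=> h; apply: mvz; rewrite andbC.
rewrite (split2 _ _ _ _ _ _ (mvx xi) (mvy xi) erefl erefl (mv xi) (id eta)).
rewrite (split2 _ _ _ _ _ _ (mvx' xi) (mvy' xi) erefl erefl (mv' xi) (id eta)).
rewrite (split2 _ _ _ _ _ _ erefl erefl (mvx eta) (mvy eta) (id xi) (mv eta)).
rewrite (split2 _ _ _ _ _ _ erefl erefl (mvx' eta) (mvy' eta) (id xi) (mv' eta)).
rewrite (split2 xi eta _ _ _ _ erefl erefl erefl erefl (id xi) (id eta)) (p_sym y x).
have := two_site_duality m_gt0 (xi x) (xi y) (eta x) (eta y).
set e := d (xi x) (eta x); set e' := d (xi y) (eta y).
set a1 := d (xi x).-1 _; set a2 := d (xi y).+1 _; set a3 := d (xi x).+1 _.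
set a4 := d (xi y).-1 _; set a5 := d _ (eta x).-1; set a6 := d _ (eta y).+1.
set a7 := d _ (eta x).+1; set a8 := d _ (eta y).-1.
move=> /eqP; rewrite -subr_eq0 => /eqP h.
rewrite -[RHS](mulr0 (4 * p x y * q)) -h.
by field.
Qed.

(** Occupation numbers are at most [N] and [N'], so finitely many values of [duality1] occur; their
    sum bounds each of them. *)
Lemma duality_bounded_finite N N' : exists M, forall xi eta,
  occ N xi -> occ N' eta -> 0 <= duality m xi eta <= M.
Proof.
pose M0 : R := \sum_(k < N.+1) \sum_(l < N'.+1) d k l.
have dM k l : (k <= N)%N -> (l <= N')%N -> d k l <= M0.
  move=> kN lN; rewrite -ltnS in kN; rewrite -ltnS in lN.
  rewrite /M0 (bigD1 (Ordinal kN))//= (bigD1 (Ordinal lN))//= -addrA lerDl addr_ge0//.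
    by apply: sumr_ge0 => j _; exact: duality1_ge0.
  by apply: sumr_ge0 => i _; apply: sumr_ge0 => j _; exact: duality1_ge0.
exists (M0 ^+ #|T|) => _ _ [s sN <-] [s' sN' <-]; rewrite dualityE_finite.
rewrite prodr_ge0/=; last by move=> x _; exact: duality1_ge0.
rewrite -prodr_const; apply: ler_prod => x _.
by rewrite duality1_ge0//= dM// -?sN -?sN' /conf count_size.
Qed.

End FiniteSelfDuality.

(** * Moments of the product measure *)

Section FactorialMoments.
Variables (R : realType) (m : R) (lam : R).
Hypothesis m_gt0 : 0 < m.
Hypothesis lam01 : 0 <= lam < 1.
Local Notation d := (duality1 m).
Local Notation mass := (nu_mass m lam).
Hypothesis mass_sum : (\sum_(0 <= n <oo) (mass n)%:E = 1)%E.

Lemma nu_mass_ge0 n : 0 <= mass n.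
Proof.
have /andP[l0 _] := lam01.
rewrite /nu_mass mulr_ge0//; last first.
  by rewrite divr_ge0// ltW// Gamma_gt0// ?ltr_pwDl// divr_gt0.
by rewrite mulr_ge0 ?powR_ge0// divr_ge0// exprn_ge0.
Qed.

Lemma nu_massS n : n.+1%:R * mass n.+1 = lam * (m / 2 + n%:R) * mass n.
Proof.
have an : 0 < m / 2 + n%:R by rewrite ltr_pwDl// divr_gt0.
have e : m / 2 + n.+1%:R = m / 2 + n%:R + 1 by rewrite -(natr1 n) addrA.
rewrite /nu_mass e GammaS// factS natrM exprS.
have n0 : n.+1%:R != 0 :> R by rewrite pnatr_eq0.
have f0 : n`!%:R != 0 :> R by rewrite pnatr_eq0 -lt0n fact_gt0.
have g0 : Gamma (m / 2) != 0 by rewrite gt_eqF// Gamma_gt0// divr_gt0.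
have key (A B D E F u x y : R) : D != 0 -> E != 0 -> F != 0 ->
    F * (A * (x * y / (F * E)) * (u * B / D)) = x * u * (A * (y / E) * (B / D)).
  by move=> D0 E0 F0; field; rewrite D0 E0 F0.
exact: key.
Qed.

Local Opaque nu_mass duality1.

(** After multiplication by m/2 + k, the factor m/2 + l from [nu_massS] splits as (l - k) + (m/2 +
    k), one summand for each term on the right. *)
Lemma moment_term_rec k l :
  d k.+1 l.+1 * mass l.+1 = lam * (d k.+1 l * mass l + d k l * mass l).
Proof.
have ak : m / 2 + k%:R != 0 by rewrite gt_eqF// ltr_pwDl// divr_gt0.
have hS := duality1S m_gt0 k l; have hSS := duality1SS m_gt0 k l.
have hm := nu_massS l.
have key (a k' l' s x0 x1 x2 M M1 : R) :
    (a + k') * x2 = (l' - k') * x0 -> (a + k') * x1 = s * x0 -> s * M1 = lam * (a + l') * M ->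
    (a + k') * (x1 * M1) = (a + k') * (lam * (x2 * M + x0 * M)).
  move=> h2 h1 hM1; rewrite mulrA h1 mulrAC hM1.
  transitivity (lam * (((a + k') * x2) * M + (a + k') * x0 * M)); last by ring.
  by rewrite h2; ring.
by apply: (mulfI ak); exact: key hm.
Qed.

Definition moment_partial k n : R := \sum_(0 <= l < n) d k l * mass l.

(* The negative binomial series is never summed: its value at k = 0 is known since nu
   is a probability, and this recursion propagates it to all k. *)
Lemma moment_partial_rec k n :
  moment_partial k.+1 n.+1 = lam * (moment_partial k.+1 n + moment_partial k n).
Proof.
rewrite /moment_partial big_nat_recl// duality1S0 mul0r add0r.
rewrite [LHS](eq_bigr _ (fun l _ => moment_term_rec k l)).
by rewrite -mulr_sumr big_split.
Qed.

Lemma nondecreasing_moment_partial k : nondecreasing_seq (moment_partial k).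
Proof.
move=> n1 n2 n12; rewrite /moment_partial [leRHS](@big_cat_nat _ _ _ n1)//= lerDl.
by apply: sumr_ge0 => l _; rewrite mulr_ge0 ?duality1_ge0 ?nu_mass_ge0.
Qed.

(** Monotonicity in [n] turns the recursion into an upper bound, since [lam < 1]. The limit v then
    exists and solves v = lam (v + rho^k) with rho = lam / (1 - lam). *)
Lemma cvg_moment_partial k : moment_partial k n @[n --> \oo] --> (lam / (1 - lam)) ^+ k.
Proof.
have /andP[l0 l1] := lam01.
elim: k => [|k IH].
  have cv : (\sum_(0 <= i < n) (mass i)%:E)%E @[n --> \oo] --> 1%:E.
    by rewrite -mass_sum; apply: is_cvg_nneseries => n _ _; rewrite lee_fin nu_mass_ge0.
  rewrite expr0; apply: (@fine_cvg _ _ _ _ (EFin \o moment_partial 0)).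
  suff -> : EFin \o moment_partial 0 = (fun n => (\sum_(0 <= i < n) (mass i)%:E)%E) by [].
  apply/funext => n /=; rewrite /moment_partial -sumEFin.
  by apply: eq_bigr => i _; rewrite duality10// mul1r.
have ub n : moment_partial k.+1 n <= lam / (1 - lam) * (lam / (1 - lam)) ^+ k.
  have h1 := nondecreasing_moment_partial k.+1 (leqnSn n).
  have h2 : moment_partial k n <= (lam / (1 - lam)) ^+ k.
    rewrite -(cvg_lim _ IH)//; apply: nondecreasing_cvgn_le; last exact: cvgP IH.
    exact: nondecreasing_moment_partial.
  rewrite moment_partial_rec in h1.
  have h3 := ler_wpM2l l0 h2.
  rewrite mulrAC ler_pdivlMr ?subr_gt0//; lra.
have cv : cvgn (moment_partial k.+1).
  apply: nondecreasing_is_cvgn; first exact: nondecreasing_moment_partial.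
  by exists (lam / (1 - lam) * (lam / (1 - lam)) ^+ k) => _ [n _ <-].
set v := limn (moment_partial k.+1).
have cS : moment_partial k.+1 n.+1 @[n --> \oo] --> v by rewrite (cvg_shiftS (moment_partial k.+1)).
have cR : lam * (moment_partial k.+1 n + moment_partial k n) @[n --> \oo] -->
    lam * (v + (lam / (1 - lam)) ^+ k).
  by apply: cvgM; [exact: cvg_cst|exact: cvgD].
have hv : v = lam * (v + (lam / (1 - lam)) ^+ k).
  have e : (fun n => moment_partial k.+1 n.+1) =
      (fun n => lam * (moment_partial k.+1 n + moment_partial k n)).
    by apply/funext => n; rewrite moment_partial_rec.
  by rewrite e in cS; exact: (cvg_unique _ cS cR).
have -> : (lam / (1 - lam)) ^+ k.+1 = v.
  have h1 : 1 - lam != 0 by rewrite gt_eqF ?subr_gt0.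
  apply: (mulfI h1); rewrite exprS mulrA mulrCA mulfV// mulr1.
  by rewrite mulrBl mul1r {1}hv; ring.
exact: cv.
Qed.

Lemma duality_moment1 k :
  (\sum_(0 <= l <oo) (d k l * mass l)%:E = ((lam / (1 - lam)) ^+ k)%:E)%E.
Proof.
apply/cvg_lim => //.
suff -> : (fun n => (\sum_(0 <= l < n) (d k l * mass l)%:E)%E) = EFin \o moment_partial k.
  by apply: cvg_EFin; [exact: nearW|exact: cvg_moment_partial].
by apply/funext => n /=; rewrite sumEFin.
Qed.

End FactorialMoments.

Section ProductMeasureMoments.
Variables (R : realType) (m : R) (S : countType) (lam : S -> R).
Hypothesis m_gt0 : 0 < m.
Hypothesis lam01 : forall x, 0 <= lam x < 1.
Variable nu : probability (config S) R.
Hypothesis nu_product : is_nu_product m lam nu.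
Implicit Types (s : seq S) (F : S -> nat -> R).

Lemma measurable_fun_coordinate_comp (x : S) (f : nat -> R) :
  measurable_fun [set: config S] (fun eta : config S => f (eta x)).
Proof. by move=> _ B _; rewrite setTI; exact: (measurable_coordinate x (f @^-1` B)). Qed.

(** The rectangle over one site with full side is the whole space. *)
Lemma nu_marginal_sum x : (\sum_(0 <= n <oo) (nu_mass m (lam x) n)%:E = 1)%E.
Proof.
rewrite nneseries_esumT; last by move=> n; rewrite lee_fin nu_mass_ge0.
rewrite -[LHS]/(nu_marginal m (lam x) setT).
have := @nu_product [:: x] (fun=> setT) isT; rewrite big_seq1 => <-.
rewrite [X in nu X](_ : _ = setT) ?probability_setT//.
by apply/seteqP; split => // eta _.
Qed.

Lemma nneseries_pick (k : nat) (c : nat -> \bar R) :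
  (\sum_(0 <= n <oo) (if k == n then c n else 0) = c k)%E.
Proof.
apply/cvg_lim => //; apply: cvg_near_cst; near=> n.
rewrite big_mkord.
have kn : (k < n)%N by near: n; exact: nbhs_infty_gt.
rewrite (bigD1 (Ordinal kn))//= eqxx big1 ?adde0// => i ik.
by rewrite ifN//; apply: contraNneq ik => e; apply/eqP/val_inj.
Unshelve. all: by end_near. Qed.

(* Induction on s1: decomposing along the value of one coordinate moves it to the
   list s2 of frozen coordinates. *)
Lemma integral_coordinates s1 s2 F (v : S -> R) (a : S -> nat) :
  uniq (s1 ++ s2) -> (forall x n, 0 <= F x n) ->
  (forall x, x \in s1 -> (\sum_(0 <= n <oo) (F x n * nu_mass m (lam x) n)%:E = (v x)%:E)%E) ->
  (\int[nu]_eta (\prod_(x <- s1) F x (eta x) * \prod_(x <- s2) (eta x == a x)%:R)%:E =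
   (\prod_(x <- s1) v x * \prod_(x <- s2) nu_mass m (lam x) (a x))%:E)%E.
Proof.
move=> + F0; elim: s1 s2 a => [|x s1 IH] s2 a us Fv.
  (* With all coordinates frozen, the integrand is the indicator of a rectangle with singleton
     sides. *)
  pose E := [set eta : config S | forall x, x \in s2 -> [set a x] (eta x)].
  have prodE (eta : config S) : \prod_(x <- s2) (eta x == a x)%:R = \1_E eta :> R.
    have -> : \prod_(x <- s2) (eta x == a x)%:R = (all (fun x => eta x == a x) s2)%:R :> R.
      elim: s2 {us E} => [|y s2 IH]; first by rewrite big_nil.
      by rewrite big_cons IH /= -natrM mulnb.
    rewrite indicE; suff -> : (eta \in E) = all (fun x => eta x == a x) s2 by [].
    apply/idP/idP; first by rewrite inE => h; apply/allP => y /h /= ->.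
    by move=> /allP h; rewrite inE => y /h /eqP.
  have mE : measurable E.
    have -> : E = \big[setI/setT]_(x <- s2) [set eta | [set a x] (eta x)].
      rewrite -bigcap_seq; apply/seteqP; split => eta h y ys; exact: h.
    by apply: bigsetI_measurable => y _; exact: measurable_coordinate.
  rewrite big_nil mul1r; under eq_integral do rewrite big_nil mul1r prodE.
  rewrite integral_indic// setIT.
  transitivity (\prod_(x <- s2) nu_marginal m (lam x) [set a x])%E.
    exact: (nu_product (fun x => [set a x]) us).
  rewrite -prodEFin; apply: eq_bigr => y _.
  by rewrite /nu_marginal esum_set1// lee_fin nu_mass_ge0.
have [xs1 xs2] : x \notin s1 /\ x \notin s2.
  by move: us => /= /andP[]; rewrite mem_cat negb_or => /andP[].
have us' : uniq (s1 ++ x :: s2).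
  by rewrite -cat1s uniq_catCA.
pose a' n y := if y == x then n else a y.
pose G n eta := F x n * (\prod_(y <- s1) F y (eta y) *
  \prod_(y <- x :: s2) (eta y == a' n y)%:R).
have a'E n y : y \in s2 -> a' n y = a y.
  by move=> ys; rewrite /a'; case: eqP => // yx; rewrite -yx ys in xs2.
have GE n (eta : config S) : G n eta =
    if eta x == n then
      F x n * (\prod_(y <- s1) F y (eta y) * \prod_(y <- s2) (eta y == a y)%:R)
    else 0.
  rewrite /G big_cons {1}/a' eqxx; case: (eta x == n); last by rewrite mul0r !mulr0.
  rewrite mul1r; congr (_ * (_ * _)).
  by apply: eq_big_seq => y ys; rewrite a'E.
have G0 n eta : 0 <= G n eta.
  by rewrite /G mulr_ge0 ?mulr_ge0 ?prodr_ge0.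
have IHn n : (\int[nu]_eta (\prod_(y <- s1) F y (eta y) *
    \prod_(y <- x :: s2) (eta y == a' n y)%:R)%:E =
   (\prod_(y <- s1) v y * \prod_(y <- x :: s2) nu_mass m (lam y) (a' n y))%:E)%E.
  by apply: IH => // y ys; apply: Fv; rewrite inE ys orbT.
have meas n : measurable_fun [set: config S] (fun eta : config S => \prod_(y <- s1) F y (eta y) *
    \prod_(y <- x :: s2) (eta y == a' n y)%:R).
  apply: measurable_funM; apply: measurable_prod => y _.
    exact: measurable_fun_coordinate_comp.
  exact: (measurable_fun_coordinate_comp y (fun k => (k == a' n y)%:R)).
transitivity (\int[nu]_eta \sum_(0 <= n <oo) (G n eta)%:E)%E.
  apply: eq_integral => eta _; rewrite big_cons -mulrA.
  rewrite -(nneseries_pick (eta x) (fun n =>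
    (F x n * (\prod_(y <- s1) F y (eta y) * \prod_(y <- s2) (eta y == a y)%:R))%:E)).
  by apply: eq_eseriesr => n _; rewrite GE; case: ifP.
rewrite integral_nneseries//; last 2 first.
- by move=> n; apply/measurable_EFinP; apply: measurable_funM => //; exact: meas.
- by move=> n eta _; rewrite lee_fin G0.
have step n : (\int[nu]_eta (G n eta)%:E =
    (\prod_(y <- s1) v y * \prod_(y <- s2) nu_mass m (lam y) (a y))%:E *
    (F x n * nu_mass m (lam x) n)%:E)%E.
  under eq_integral do rewrite /G EFinM.
  rewrite ge0_integralZl_EFin//; last 2 first.
  - by move=> eta _; rewrite lee_fin mulr_ge0 ?prodr_ge0.
  - by apply/measurable_EFinP; exact: meas.
  rewrite IHn big_cons {1}/a' eqxx -!EFinM.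
  have -> : \prod_(y <- s2) nu_mass m (lam y) (a' n y) = \prod_(y <- s2) nu_mass m (lam y) (a y).
    by apply: eq_big_seq => y ys; rewrite a'E.
  by congr EFin; ring.
under eq_eseriesr do rewrite step.
rewrite nneseriesZl; last by move=> n _; rewrite lee_fin mulr_ge0 ?nu_mass_ge0.
by rewrite Fv ?mem_head// -EFinM big_cons; congr EFin; ring.
Qed.

Lemma duality_conf s (eta : config S) :
  duality m (conf s) eta = \prod_(x <- undup s) duality1 m (count_mem x s) (eta x).
Proof.
rewrite /duality (fsbigE (undup s)) ?undup_uniq//; last first.
  by move=> x _; rewrite mem_undup conf_count -eqn0Ngt => /eqP ->; rewrite duality10.
by apply: eq_bigl => x; rewrite in_setT.
Qed.

Lemma measurable_duality_conf s :
  measurable_fun [set: config S] (fun eta : config S => (duality m (conf s) eta)%:E).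
Proof.
apply/measurable_EFinP.
have -> : duality m (conf s) =
    fun eta : config S => \prod_(x <- undup s) duality1 m (count_mem x s) (eta x).
  by apply/funext => eta; rewrite duality_conf.
by apply: measurable_prod => x _; exact: measurable_fun_coordinate_comp.
Qed.

Lemma integral_duality_conf s :
  (\int[nu]_eta (duality m (conf s) eta)%:E =
   (power_product (fun x => lam x / (1 - lam x)) (conf s))%:E)%E.
Proof.
have -> : power_product (fun x => lam x / (1 - lam x)) (conf s) =
    \prod_(x <- undup s) (lam x / (1 - lam x)) ^+ count_mem x s.
  by rewrite power_product_conf -[LHS]big_undup_iterop_count.
have := @integral_coordinates (undup s) [::] (fun x => duality1 m (count_mem x s))
  (fun x => (lam x / (1 - lam x)) ^+ count_mem x s) (fun=> 0%N).
rewrite cats0 big_nil mulr1 => <-.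
- by apply: eq_integral => eta _; rewrite big_nil mulr1 duality_conf.
- exact: undup_uniq.
- by move=> x n; exact: duality1_ge0.
- by move=> x _; exact: (duality_moment1 m_gt0 (lam01 x) (nu_marginal_sum x)).
Qed.

End ProductMeasureMoments.

(** * Integrals over a sector as series *)

Section IntegralsOverOccupations.
Variables (R : realType) (S : countType).
Variable mu : {measure set (config S) -> \bar R}.
Variable s0 : seq S.
Local Notation N := (size s0).
Hypothesis mu_fin : (mu (occ N) < +oo)%E.

(** The points and weights are the same for all [h]. An exchange with another integral thus becomes
    termwise integration of a nonnegative series. *)
Lemma integral_occ_series : exists (c : nat -> config S) (w : nat -> R),
  [/\ (forall n, occ N (c n)), (forall n, 0 <= w n) &
      forall h : config S -> \bar R, (forall zeta, occ N zeta -> 0 <= h zeta)%E ->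
      (\int[mu]_(zeta in occ N) h zeta = \sum_(0 <= n <oo) ((w n)%:E * h (c n)))%E].
Proof.
have [f finj] := countable_injP _ (countable_occ S N).
pose F n := occ N `&` f @^-1` [set n].
have mF n : measurable (F n).
  apply: countable_measurable; first exact: measurable_config1.
  by apply: sub_countable (countable_occ S N); apply: subset_card_le; exact: subIsetl.
(* If no configuration has code n, the default point [conf s0] is taken; its weight is the measure
   of the empty set. *)
pose c n := xget (conf s0) (F n).
have cN n : occ N (c n).
  by rewrite /c; case: xgetP => [z _ []//|_]; exact: occ_conf.
have Fc n z : F n z -> z = c n.
  move=> Fz; rewrite /c; case: xgetP => [z' _ Fz'|/(_ z)//].
  by apply: finj; rewrite ?inE; [case: Fz|case: Fz'|rewrite Fz.2 Fz'.2].
have Ffin n : mu (F n) \is a fin_num.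
  rewrite ge0_fin_numE//; apply: le_lt_trans mu_fin.
  by apply: le_measure; rewrite ?inE//; [exact: measurable_occ|exact: subIsetl].
exists c, (fun n => fine (mu (F n))); split=> // h h0.
have FU : occ N = \bigcup_n F n.
  apply/seteqP; split=> [z zN|z [n _ []]//]; by exists (f z).
rewrite [in LHS]FU ge0_integral_bigcup//.
- apply: eq_eseriesr => n _; rewrite fineK//.
  rewrite (eq_integral (cst (h (c n)))); last by move=> z; rewrite inE => /Fc ->.
  by rewrite integral_cst// muleC.
- by rewrite -FU; exact: measurable_fun_occ.
- by move=> z; rewrite -FU; exact: h0.
- by move=> i j _ _ [z [[_ <-] [_ <-]]].
Qed.

End IntegralsOverOccupations.

(** * Averaging the dual expectation over the product measure *)

Section DualityMoments.
Variables (R : realType) (m : R) (S : countType) (lam : S -> R).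
Hypothesis m_gt0 : 0 < m.
Hypothesis lam01 : forall x, 0 <= lam x < 1.
Variable nu : probability (config S) R.
Hypothesis nu_product : is_nu_product m lam nu.
Variable mu : {measure set (config S) -> \bar R}.
Variable s0 : seq S.
Local Notation N := (size s0).
Hypothesis mu_fin : (mu (occ N) < +oo)%E.

Lemma duality_ge0 (s : seq S) (eta : config S) : 0 <= duality m (conf s) eta.
Proof. by rewrite duality_conf// prodr_ge0// => x _; exact: duality1_ge0. Qed.

Lemma measurable_integral_duality : measurable_fun [set: config S]
  (fun eta => \int[mu]_(zeta in occ N) (duality m zeta eta)%:E)%E.
Proof.
have [c [w [cN w0 hE]]] := integral_occ_series mu_fin.
have -> : (fun eta => \int[mu]_(zeta in occ N) (duality m zeta eta)%:E)%E =
    (fun eta => \sum_(0 <= n <oo) ((w n)%:E * (duality m (c n) eta)%:E))%E.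
  apply/funext => eta; apply: hE => _ [s _ <-].
  by rewrite lee_fin duality_ge0.
apply: ge0_emeasurable_sum => // [n eta _ _|n _].
  by have [s _ <-] := cN n; rewrite -EFinM lee_fin mulr_ge0 ?duality_ge0.
have [s _ <-] := cN n; apply: emeasurable_funM => //.
exact: measurable_duality_conf.
Qed.

Lemma integral_duality_swap :
  (\int[nu]_eta \int[mu]_(zeta in occ N) (duality m zeta eta)%:E =
   \int[mu]_(zeta in occ N) (power_product (fun x => lam x / (1 - lam x)) zeta)%:E)%E.
Proof.
have [c [w [cN w0 hE]]] := integral_occ_series mu_fin.
transitivity (\int[nu]_eta \sum_(0 <= n <oo) ((w n)%:E * (duality m (c n) eta)%:E))%E.
  apply: eq_integral => eta _; apply: hE => _ [s _ <-].
  by rewrite lee_fin duality_ge0.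
rewrite integral_nneseries//; last 2 first.
- move=> n; have [s _ <-] := cN n; apply: emeasurable_funM => //.
  exact: measurable_duality_conf.
- by move=> n eta _; have [s _ <-] := cN n; rewrite -EFinM lee_fin mulr_ge0 ?duality_ge0.
rewrite hE; last first.
  move=> _ [s _ <-]; rewrite lee_fin power_product_conf prodr_ge0// => x _.
  by have /andP[? ?] := lam01 x; rewrite divr_ge0// subr_ge0 ltW.
apply: eq_eseriesr => n _; have [s _ <-] := cN n.
rewrite ge0_integralZl_EFin//.
- by rewrite (integral_duality_conf m_gt0 lam01 nu_product).
- by move=> eta _; rewrite lee_fin duality_ge0.
- exact: measurable_duality_conf.
Qed.

End DualityMoments.

(** * The symmetric inclusion process *)

Section SymmetricInclusionProcess.
Variables (R : realType) (m : R) (S : site_space) (p : site S -> site S -> R).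
Hypothesis m_gt0 : 0 < m.
Hypothesis p_walk : random_walk p.
Variable P : R -> R.-pker config (site S) ~> config (site S).
Hypothesis P_SIP : is_SIP m p P.
Implicit Types (s : seq (site S)).

Lemma allowed_conf s : allowed R (conf s).
Proof.
case: S s => [//|d] /= s; exists (size s)%:R, 0%N => y.
by rewrite expr0 mulr1 ler_nat /conf count_size.
Qed.

Let p_ge0 := walk_ge0 p_walk.
Let p_sym := walk_sym p_walk.
Let p_sum := walk_sum p_walk.
Let p_diag := walk_diag p_walk.

Let P_start s A : measurable A -> P 0 (conf s) A = \d_(conf s) A.
Proof. by move=> mA; apply: (sip_start P_SIP) => //; exact: allowed_conf. Qed.

Let P_markov (a b : R) s A : 0 <= a -> 0 <= b -> measurable A ->
  P (a + b) (conf s) A = (\int[P a (conf s)]_zeta P b zeta A)%E.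
Proof. by move=> a0 b0 mA; apply: (sip_markov P_SIP) => //; exact: allowed_conf. Qed.

Let P_generator s (f : config (site S) -> R) :
  measurable_fun [set: config (site S)] f -> (exists M : R, forall zeta, `|f zeta| <= M) ->
  half_line_derivative (fun t => \int[P t (conf s)]_zeta f zeta)
    (fun t => \int[P t (conf s)]_zeta generator m p f zeta).
Proof.
move=> mf fM t t0.
have [] // := sip_generator P_SIP (f := f) (allowed_conf s) _ t0.
(* Starting from a finite configuration, test functions need not be local; power products and
   indicators of [occ N] are not local in general. *)
by split=> //; right; exact: finite_config_conf.
Qed.

Let P_setC_occ s t : 0 <= t -> P t (conf s) (~` occ (size s)) = 0%E.
Proof. exact: (kernel_setC_occ P_start P_generator erefl). Qed.

Lemma SIP_integral_occ s t (f : config (site S) -> \bar R) : 0 <= t ->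
  (forall zeta, 0 <= f zeta)%E ->
  (\int[P t (conf s)]_zeta f zeta = \int[P t (conf s)]_(zeta in occ (size s)) f zeta)%E.
Proof.
move=> t0 f0; apply: ge0_integral_full_measure => //.
- exact: measurable_occ.
- exact: P_setC_occ.
- exact: measurable_fun_occ.
Qed.

Lemma SIP_duality_eq M (H : config (site S) -> config (site S) -> R) s s' t :
  (forall xi eta, occ (size s) xi -> occ (size s') eta -> 0 <= H xi eta <= M) ->
  (forall xi eta, occ (size s) xi -> occ (size s') eta ->
    generator m p (H ^~ eta) xi = generator m p (H xi) eta) ->
  0 <= t ->
  (\int[P t (conf s)]_(xi in occ (size s)) (H xi (conf s'))%:E =
   \int[P t (conf s')]_(eta in occ (size s')) (H (conf s) eta)%:E)%E.
Proof.
move=> HM HL t0.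
have b1 : bounded_on (size s) M (H ^~ (conf s')).
  by move=> xi xN; have /andP[? ?] := HM _ _ xN (occ_conf s'); rewrite ger0_norm.
have b2 : bounded_on (size s') M (H (conf s)).
  by move=> eta eN; have /andP[? ?] := HM _ _ (occ_conf s) eN; rewrite ger0_norm.
rewrite -(EFin_expect P _ _ b1) -(EFin_expect P _ _ b2).
by rewrite (duality_eq m_gt0 p_ge0 p_sum P_start P_markov P_generator HM HL t0).
Qed.

Lemma SIP_comparison (g : site S -> R) s t : (forall x, 0 <= g x) -> 0 <= t ->
  (\prod_(z <- s) \int[P t (conf [:: z])]_(zeta in occ 1) (power_product g zeta)%:E
   <= \int[P t (conf s)]_(zeta in occ (size s)) (power_product g zeta)%:E)%E.
Proof.
exact: (comparison_integral m_gt0 p_ge0 p_sym p_sum p_diag P_start P_markov P_generator).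
Qed.

End SymmetricInclusionProcess.

Lemma duality_config_ge0 (R : realType) (m : R) (S : countType) (xi eta : config S) :
  0 < m -> 0 <= duality m xi eta.
Proof.
move=> m0; rewrite /duality; apply: (big_ind (fun z : R => 0 <= z)) => // [x y|x _].
  exact: mulr_ge0.
exact: duality1_ge0.
Qed.

Lemma finite_sites_self_dual (R : realType) (m : R) (T : finType)
    (S := FiniteSites T) (p : site S -> site S -> R)
    (P : R -> R.-pker config (site S) ~> config (site S)) :
  0 < m -> random_walk p -> is_SIP m p P ->
  self_dual m (@allowed R S) P.
Proof.
move=> m0 hp hP t xi eta t0 xi_fin _.
have [s ->] := finite_configP xi_fin.
have [s' ->] : exists s', eta = conf s'.
  by apply: finite_configP; exact: finite_finset.
have [M HM] := duality_bounded_finite T m0 (size s) (size s').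
have D0 xi' eta' : (0 <= (duality m xi' eta' : R)%:E)%E by rewrite lee_fin duality_config_ge0.
rewrite (SIP_integral_occ hP s' t0 (D0 _ (conf s))).
rewrite (SIP_integral_occ hP s t0 (fun zeta => D0 _ zeta (conf s'))).
have HL a b (_ : occ (size s) a) (_ : occ (size s') b) :=
  generator_duality m0 (walk_sym hp) (walk_diag hp) a b.
exact: esym (SIP_duality_eq m0 hp hP HM HL t0).
Qed.

Lemma SIP_self_dual (R : realType) (m : R) (S : site_space) (p : site S -> site S -> R)
    (P : R -> R.-pker config (site S) ~> config (site S)) :
  0 < m -> random_walk p -> is_SIP m p P -> self_dual m (@allowed R S) P.
Proof.
case: S p P => [T|d] p P m0 hp hP; first exact: finite_sites_self_dual hP.
exact: (sip_duality hP).
Qed.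

(** * Duality moments at time t *)

Section Moments.
Variables (R : realType) (m : R) (S : site_space) (p : site S -> site S -> R).
Hypothesis m_gt0 : 0 < m.
Hypothesis p_walk : random_walk p.
Variable P : R -> R.-pker config (site S) ~> config (site S).
Hypothesis P_SIP : is_SIP m p P.
Variable lam : site S -> R.
Hypothesis lam01 : forall x, 0 <= lam x < 1.
Variable nu : probability (config (site S)) R.
Hypothesis nu_product : is_nu_product m lam nu.
Hypothesis nu_allowed : {ae nu, forall eta : config (site S), allowed R eta}.
Variable t : R.
Hypothesis t_ge0 : 0 <= t.
Implicit Types (s : seq (site S)).

(** The duality moment function of nu S_t, with the law written as a double integral and the points
    as a list. *)
Definition time_moment s : \bar R :=
  (\int[nu]_eta \int[P t eta]_zeta (duality m (conf s) zeta)%:E)%E.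

Lemma duality_moment_time n (x : 'I_n -> site S) :
  duality_moment m (law_at P nu t) x = time_moment (codom x).
Proof.
rewrite /duality_moment sum_deltaE integral_law_at//.
- by move=> zeta; rewrite lee_fin duality_config_ge0.
- exact: measurable_duality_conf.
Qed.

Lemma measurable_kernel_integral (f : config (site S) -> \bar R) :
  (forall zeta, 0 <= f zeta)%E -> measurable_fun [set: config (site S)] f ->
  measurable_fun [set: config (site S)] (fun eta => \int[P t eta]_zeta f zeta)%E.
Proof.
move=> f0 mf; apply: (measurable_fun_integral_kernel (l := P t)) => // U mU.
exact: measurable_kernel.
Qed.

Lemma time_momentE s : time_moment s =
  (\int[P t (conf s)]_(zeta in occ (size s))
     (power_product (fun x => lam x / (1 - lam x)) zeta)%:E)%E.
Proof.
have fin : (P t (conf s) (occ (size s)) < +oo)%E.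
  by apply: kernel_lt_pinfty; exact: measurable_occ.
rewrite -(integral_duality_swap m_gt0 lam01 nu_product fin).
(* Self-duality is available at allowed configurations only, that is for nu-almost every [eta]. *)
apply: ae_eq_integral => //.
- apply: measurable_kernel_integral; last exact: measurable_duality_conf.
  by move=> zeta; rewrite lee_fin duality_config_ge0.
- exact: measurable_integral_duality.
- apply: filterS nu_allowed => eta eta_allowed _.
  rewrite (SIP_self_dual m_gt0 p_walk P_SIP t_ge0 (finite_config_conf s) eta_allowed).
  by rewrite (SIP_integral_occ P_SIP)// => zeta; rewrite lee_fin duality_config_ge0.
Qed.

Lemma time_moment_prod s : (\prod_(z <- s) time_moment [:: z] <= time_moment s)%E.
Proof.
rewrite time_momentE; under eq_bigr do rewrite time_momentE.
apply: (SIP_comparison m_gt0 p_walk P_SIP) => // x.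
by have /andP[? ?] := lam01 x; rewrite divr_ge0// subr_ge0 ltW.
Qed.

Lemma time_momentZ (c : R) s : 0 <= c -> (c%:E * time_moment s =
  \int[nu]_eta \int[P t eta]_zeta (c * duality m (conf s) zeta)%:E)%E.
Proof.
move=> c0.
have D0 zeta : (0 <= (duality m (conf s) zeta)%:E)%E by rewrite lee_fin duality_config_ge0.
have mD := measurable_duality_conf m_gt0 s.
rewrite /time_moment -ge0_integralZl_EFin//; last 2 first.
- by move=> eta _; exact: integral_ge0.
- exact: measurable_kernel_integral.
by apply: eq_integral => eta _; rewrite -ge0_integralZl_EFin.
Qed.

Lemma duality1_1 l : m / 2 * duality1 m 1 l = l%:R.
Proof. by have := duality1S m_gt0 0 l; rewrite duality10// addr0 subr0 mulr1. Qed.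

Lemma time_moment_coordinate x :
  (\int[nu]_eta \int[P t eta]_zeta ((zeta x)%:R)%:E = (m / 2)%:E * time_moment [:: x])%E.
Proof.
have a0 : 0 <= m / 2 by rewrite divr_ge0// ltW.
rewrite (time_momentZ _ a0).
apply: eq_integral => eta _; apply: eq_integral => zeta _.
by rewrite duality_conf//= big_seq1 eqxx addn0 duality1_1.
Qed.

(** Distinct sites give equality. On the diagonal, with a = m/2 and z particles, a (a + 1) d(2, z) =
    z (z - 1), so the left side is at most z^2. *)
Lemma duality_pair_le x y (zeta : config (site S)) :
  (m / 2) ^+ 2 * duality m (conf [:: x; y]) zeta <= (zeta x)%:R * (zeta y)%:R.
Proof.
rewrite duality_conf//=; have [<-|xy] := eqVneq x y.
  rewrite mem_head big_seq1 eqxx /=.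
  have := duality1S m_gt0 1 (zeta x); have := duality1_ge0 m_gt0 2 (zeta x).
  have a0 : 0 < m / 2 by rewrite divr_gt0.
  have z0 : 0 <= (zeta x)%:R :> R by [].
  move: (duality1_1 (zeta x)) a0 z0.
  move: (m / 2) (duality1 m 1 _) (duality1 m 2 _) ((zeta x)%:R) => a e1 e2 z.
  move=> h1 a0 z0 e20 h2.
  have h3 : a ^+ 2 * e2 + a * e2 = (z - 1) * z.
    have -> : a ^+ 2 * e2 + a * e2 = a * ((a + 1) * e2) by ring.
    by rewrite h2 -h1; ring.
  have h4 : 0 <= a * e2 by rewrite mulr_ge0// ltW.
  lra.
rewrite inE (negbTE xy) /= big_cons big_seq1 /= !eqxx (negbTE xy) eq_sym (negbTE xy) /=.
rewrite !addn0 add0n -(duality1_1 (zeta x)) -(duality1_1 (zeta y)).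
by rewrite le_eqVlt; apply/orP; left; apply/eqP; ring.
Qed.
Lemma time_moment_pair x y :
  (((m / 2) ^+ 2)%:E * time_moment [:: x; y] <=
   \int[nu]_eta \int[P t eta]_zeta ((zeta x)%:R * (zeta y)%:R)%:E)%E.
Proof.
have mD : measurable_fun [set: config (site S)]
    (fun zeta => ((m / 2) ^+ 2 * duality m (conf [:: x; y]) zeta)%:E).
  apply/measurable_EFinP; apply: measurable_funM => //.
  by apply/measurable_EFinP; exact: measurable_duality_conf.
have mxy : measurable_fun [set: config (site S)]
    (fun zeta : config (site S) => ((zeta x)%:R * (zeta y)%:R : R)%:E).
  apply/measurable_EFinP; apply: measurable_funM.
    exact: (measurable_fun_coordinate_comp x (fun k => k%:R)).
  exact: (measurable_fun_coordinate_comp y (fun k => k%:R)).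
have D0 zeta : (0 <= ((m / 2) ^+ 2 * duality m (conf [:: x; y]) zeta)%:E)%E.
  by rewrite lee_fin mulr_ge0 ?sqr_ge0 ?duality_config_ge0.
have xy0 (zeta : config (site S)) : (0 <= ((zeta x)%:R * (zeta y)%:R : R)%:E)%E.
  by rewrite lee_fin mulr_ge0.
rewrite time_momentZ ?sqr_ge0//; apply: ge0_le_integral => //.
- by move=> eta _; exact: integral_ge0.
- exact: measurable_kernel_integral.
- exact: measurable_kernel_integral.
move=> eta _; apply: ge0_le_integral => // zeta _.
by rewrite lee_fin duality_pair_le.
Qed.

End Moments.

Theorem proposition1 (R : realType) (m : R) (hm : 0 < m)
    (S : site_space) (p : site S -> site S -> R) (hp : random_walk p)
    (P : R -> R.-pker config (site S) ~> config (site S)) (hP : is_SIP m p P)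
    (lam : site S -> R) (hlam : forall x, 0 <= lam x < 1)
    (nu : probability (config (site S)) R) (hnu : is_nu_product m lam nu)
    (hallowed : {ae nu, forall eta : config (site S), allowed R eta})
    (t : R) (ht : 0 <= t) :
  (forall (n : nat) (x : 'I_n -> site S), (1 <= n)%N ->
     (\prod_(i < n) duality_moment m (law_at P nu t) (fun _ : 'I_1 => x i)
      <= duality_moment m (law_at P nu t) x)%E)
  /\
  (forall x y : site S,
     ((\int[nu]_eta \int[P t eta]_zeta ((zeta x)%:R)%:E)
      * (\int[nu]_eta \int[P t eta]_zeta ((zeta y)%:R)%:E)
      <= \int[nu]_eta \int[P t eta]_zeta ((zeta x)%:R * (zeta y)%:R)%:E)%E).
Proof.
have moment_prod := time_moment_prod hm hp hP hlam hnu hallowed ht.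
split=> [n x _|x y].
  have momentE k (y : 'I_k -> site S) :
      duality_moment m (law_at P nu t) y = time_moment m P nu t (codom y).
    exact: duality_moment_time.
  rewrite (momentE n x); apply: le_trans (moment_prod (codom x)).
  rewrite codomE big_map big_enum /=.
  have codom1 i : codom (fun _ : 'I_1 => x i) = [:: x i].
    by rewrite codomE enum_ordSl enum_ord0.
  by under eq_bigr do rewrite momentE codom1.
rewrite (time_moment_coordinate hm P nu t x) (time_moment_coordinate hm P nu t y).
(* Each mean carries a factor m/2, and the two factors together match the (m/2)^2 in the bound for
   the pair. *)
apply: le_trans (time_moment_pair hm P nu t x y).
rewrite muleACA -EFinM -expr2; apply: lee_wpmul2l; first by rewrite lee_fin sqr_ge0.
by have := moment_prod [:: x; y]; rewrite big_cons big_seq1.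
Qed.
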